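(* Let $(X,d,\mathfrak m)$ be an ${\sf RCD}(K,\infty)$ space for some $K\in\mathbb R$. There exists a unique linear continuous operator $\overline{\mathrm{Pr}}:L^0_{\mathrm{Cap}}(TX)\to L^0_{\mathfrak m}(TX)$ that satisfies the following properties: (i) $\overline{\mathrm{Pr}}(\bar\nabla f)=\nabla f$ for every $f\in\mathrm{Test}(X)$; (ii) $\overline{\mathrm{Pr}}(gv)=\mathrm{Pr}(g)\,\overline{\mathrm{Pr}}(v)$ for every $g\in L^0(\mathrm{Cap})$ and $v\in L^0_{\mathrm{Cap}}(TX)$. Moreover, the operator $\overline{\mathrm{Pr}}$ satisfies $|\overline{\mathrm{Pr}}(v)|=\mathrm{Pr}(|v|)$ $\mathfrak m$-a.e. for every $v\in L^0_{\mathrm{Cap}}(TX)$.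
   Context: **Metric measure spaces and capacity.** $(X,d)$ is a complete separable metric space and $\mathfrak m\ge 0$ is a Borel measure on $X$ finite on balls. $W^{1,2}(X)$ is the usual Sobolev space of real-valued functions on the metric measure space (Cheeger; Ambrosio--Gigli--Savaré), $|Df|\in L^2(\mathfrak m)$ is the minimal weak upper gradient of $f$, and $\|f\|^2_{W^{1,2}(X)}=\|f\|^2_{L^2(\mathfrak m)}+\||Df|\|^2_{L^2(\mathfrak m)}$. For $E\subset X$, $\mathrm{Cap}(E):=\inf\|f\|^2_{W^{1,2}(X)}$ over all $f\in W^{1,2}(X)$ with $f\ge 1$ $\mathfrak m$-a.e. on some open neighbourhood of $E$ ($+\infty$ if there are none); this is an outer measure and $\mathfrak m(E)\le\mathrm{Cap}(E)$ for $E$ Borel. For $f:X\to[0,+\infty]$, $\int f\,d\mathrm{Cap}:=\int_0^{+\infty}\mathrm{Cap}(\{f>t\})\,dt$ and $\int_E f\,d\mathrm{Cap}:=\int\chi_E f\,d\mathrm{Cap}$. $L^0(\mathrm{Cap})$ (resp. $L^0(\mathfrak m)$) is the space of real-valued Borel functions on $X$ up to equality outside $\mathrm{Cap}$-null (resp. $\mathfrak m$-null) sets, and $\mathrm{Pr}:L^0(\mathrm{Cap})\to L^0(\mathfrak m)$, $[f]_{\mathrm{Cap}}\mapsto[f]_{\mathfrak m}$. Fix an increasing sequence $(A_k)_{k\in\mathbb N}$ of open sets of finite capacity such that each bounded set is contained in some $A_k$. **Quasi-continuity.** $f:X\to\mathbb R$ is quasi-continuous if for every $\varepsilon>0$ there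 is $E\subset X$ with $\mathrm{Cap}(E)<\varepsilon$ and $f|_{X\setminus E}$ continuous; $\mathcal{QC}(X)\subset L^0(\mathrm{Cap})$ is the set of classes up to $\mathrm{Cap}$-a.e. equality of such functions. On an ${\sf RCD}(K,\infty)$ space, for each $f\in W^{1,2}(X)$, $\mathsf{QCR}(f)\in\mathcal{QC}(X)$ denotes the unique element with $\mathrm{Pr}(\mathsf{QCR}(f))=f$. **$L^0(\mathrm{Cap})$-modules.** An $L^0(\mathrm{Cap})$-normed $L^0(\mathrm{Cap})$-module ($L^0(\mathrm{Cap})$-module) is $(\mathscr M,\tau,\cdot,|\cdot|)$ where $(\mathscr M,\tau)$ is a topological vector space; $\cdot:L^0(\mathrm{Cap})\times\mathscr M\to\mathscr M$ is bilinear with $f\cdot(g\cdot v)=(fg)\cdot v$, $1\cdot v=v$; $|\cdot|:\mathscr M\to L^0(\mathrm{Cap})$ satisfies $|v|\ge0$ with equality iff $v=0$, $|v+w|\le|v|+|w|$, $|f\cdot v|=|f||v|$ ($\mathrm{Cap}$-a.e.); and the distance $d_{\mathscr M}(v,w):=\sum_{k\in\mathbb N}\frac{1}{2^k(\mathrm{Cap}(A_k)\vee1)}\int_{A_k}|v-w|\wedge1\,d\mathrm{Cap}$ is complete and induces $\tau$. For a Borel partition $(E_n)_{n\in\mathbb N}$ and $v_n\in\mathscr M$, $\sum_n\chi_{E_n}v_n$ is the unique $v\in\mathscr M$ with $\chi_{E_n}v=\chi_{E_n}v_n$ for all $n$. **${\sf RCD}$ spaces, test functions, tangent $L^0(\mathfrak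 m)$-module.** ${\sf RCD}(K,\infty)$ means the usual infinitesimally Hilbertian spaces satisfying the curvature-dimension condition $CD(K,\infty)$. $L^0_{\mathfrak m}(TX)$ is the tangent $L^0(\mathfrak m)$-module (Gigli): the (unique up to unique isomorphism) complete $L^0(\mathfrak m)$-normed $L^0(\mathfrak m)$-module with a linear gradient $\nabla:W^{1,2}(X)\to L^0_{\mathfrak m}(TX)$ such that $|\nabla f|=|Df|$ $\mathfrak m$-a.e. and finite sums $\sum_i\chi_{E_i}\nabla f_i$ ($E_i$ Borel) are dense; its topology is that of convergence in $\mathfrak m$-measure on bounded sets of the pointwise norm of the difference, and it has a pointwise scalar product $\langle\cdot,\cdot\rangle$. $f\in D(\Delta)$ with $\Delta f=h\in L^2(\mathfrak m)$ means $f\in W^{1,2}(X)$ and $\int\langle\nabla f,\nabla g\rangle d\mathfrak m=-\int hg\,d\mathfrak m$ for all $g\in W^{1,2}(X)$. $\mathrm{Test}(X):=\{f\in D(\Delta)\cap L^\infty(\mathfrak m):|Df|\in L^\infty(\mathfrak m),\ \Delta f\in W^{1,2}(X)\}$; for $f\in\mathrm{Test}(X)$ one has $|Df|\in W^{1,2}(X)$. **Tangent $L^0(\mathrm{Cap})$-module.** $(L^0_{\mathrm{Cap}}(TX),\bar\nabla)$ is the couple, unique up to unique isomorphism, where $L^0_{\mathrm{Cap}}(TX)$ is an $L^0(\mathrm{Cap})$-module and $\bar\nabla:\mathrm{Test}(X)\to L^0_{\mathrm{Cap}}(TX)$ is linear, with $|\bar\nabla f|=\mathsf{QCR}(|Df|)$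 $\mathrm{Cap}$-a.e. for all $f\in\mathrm{Test}(X)$ and such that the elements $\sum_{n\in\mathbb N}\chi_{E_n}\bar\nabla f_n$ ($(E_n)$ Borel partition of $X$, $f_n\in\mathrm{Test}(X)$) are dense. *)

(* Defs.v *)
From HB Require Import structures.
From mathcomp Require Import all_boot all_order all_algebra.
From mathcomp Require Import generic_quotient.
From mathcomp Require Import all_classical all_reals all_analysis.
From mathcomp Require Import measurable_realfun.

Set Implicit Arguments.
Unset Strict Implicit.
Unset Printing Implicit Defensive.
Import Order.TTheory GRing.Theory Num.Theory.
Import numFieldNormedType.Exports.

Local Open Scope classical_set_scope.
Local Open Scope ring_scope.

HB.mixin Record isSeparableBorel (d : measure_display) (R : realType) X
    & Metric R X & Measurable d X := {
  borel_measurableE : @measurable d X = <<s @open X >> ;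
  separable_subproof : exists2 D : set X, countable D & dense D
}.

#[short(type="polishBorelType")]
HB.structure Definition PolishBorel (d : measure_display) (R : realType) :=
  { X of Metric R X & Complete X & Measurable d X & isSeparableBorel d R X }.

(* [L0 R F] is the quotient of the measurable real functions by equality outside
   negligible sets, [F] being the filter of complements of negligible sets. *)

Section L0.
Context {d : measure_display} {X : measurableType d} {R : realType}.
Variable F : filter_on X.
Implicit Types f g h : {mfun X >-> R}.

Definition L0_eq f g : bool := `[< \forall x \near F, f x = g x >].

Let L0_eq_refl : reflexive L0_eq.
Proof. by move=> f; apply/asboolP; apply: nearW. Qed.

Let L0_eq_sym : symmetric L0_eq.
Proof.
by move=> f g; apply/idP/idP => /asboolP fg; apply/asboolP;
  apply: filterS fg => x ->.
Qed.

Let L0_eq_trans : transitive L0_eq.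
Proof.
move=> g f h /asboolP fg /asboolP gh; apply/asboolP.
by apply: filterS2 fg gh => x -> ->.
Qed.

Canonical L0_eq_canonical := EquivRel L0_eq L0_eq_refl L0_eq_sym L0_eq_trans.

Local Open Scope quotient_scope.

Definition L0 : Type := {eq_quot L0_eq}.
HB.instance Definition _ := Choice.on L0.
HB.instance Definition _ := EqQuotient.on L0.

Definition L0_class f : L0 := \pi_L0 f.
Definition L0_repr (u : L0) : {mfun X >-> R} := repr u.
Coercion L0_repr : L0 >-> MeasurableFun.type.

Implicit Types u v w : L0.

Lemma L0_classE f : \forall x \near F, L0_class f x = f x.
Proof.
have : L0_eq (repr (\pi_L0 f)) f by rewrite -eqmodE reprK.
by move=> /asboolP.
Qed.

Lemma L0_classP f g : L0_class f = L0_class g <-> \forall x \near F, f x = g x.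
Proof.
split=> [/eqP|fg]; first by rewrite eqmodE => /asboolP.
by apply/eqP; rewrite eqmodE; apply/asboolP.
Qed.

Lemma L0P u v : u = v <-> \forall x \near F, u x = v x.
Proof.
split=> [->|uv]; first exact: nearW.
by rewrite -(reprK u) -(reprK v); apply/L0_classP.
Qed.

Definition L0_zero : L0 := L0_class 0.
Definition L0_one : L0 := L0_class 1.
Definition L0_opp u : L0 := L0_class (- (u : {mfun X >-> R})).
Definition L0_add u v : L0 :=
  L0_class ((u : {mfun X >-> R}) + (v : {mfun X >-> R})).
Definition L0_mul u v : L0 :=
  L0_class ((u : {mfun X >-> R}) * (v : {mfun X >-> R})).
Definition L0_scale (a : R) u : L0 := L0_class (cst a * (u : {mfun X >-> R})).

Let zeroE : \forall x \near F, L0_zero x = 0.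
Proof. exact: L0_classE. Qed.
Let oneE : \forall x \near F, L0_one x = 1.
Proof. exact: L0_classE. Qed.
Let oppE u : \forall x \near F, L0_opp u x = - u x.
Proof. exact: L0_classE. Qed.
Let addE u v : \forall x \near F, L0_add u v x = u x + v x.
Proof. exact: L0_classE. Qed.
Let mulE u v : \forall x \near F, L0_mul u v x = u x * v x.
Proof. exact: L0_classE. Qed.
Let scaleE a u : \forall x \near F, L0_scale a u x = a * u x.
Proof. exact: L0_classE. Qed.



Let addA : associative L0_add.
Proof.
move=> u v w; apply/L0P; near=> x.
rewrite (near (addE u (L0_add v w)) x)// (near (addE v w) x)//.
by rewrite (near (addE (L0_add u v) w) x)// (near (addE u v) x)// addrA.
Unshelve. all: by end_near. Qed.

Let addC : commutative L0_add.
Proof.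
move=> u v; apply/L0P; near=> x.
by rewrite (near (addE u v) x)// (near (addE v u) x)// addrC.
Unshelve. all: by end_near. Qed.

Let add0 : left_id L0_zero L0_add.
Proof.
move=> u; apply/L0P; near=> x.
by rewrite (near (addE L0_zero u) x)// (near zeroE x)// add0r.
Unshelve. all: by end_near. Qed.

Let addN : left_inverse L0_zero L0_opp L0_add.
Proof.
move=> u; apply/L0P; near=> x.
rewrite (near (addE (L0_opp u) u) x)// (near (oppE u) x)//.
by rewrite (near zeroE x)// addNr.
Unshelve. all: by end_near. Qed.

HB.instance Definition _ := GRing.isZmodule.Build L0 addA addC add0 addN.

Let mulA : associative L0_mul.
Proof.
move=> u v w; apply/L0P; near=> x.
rewrite (near (mulE u (L0_mul v w)) x)// (near (mulE v w) x)//.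
by rewrite (near (mulE (L0_mul u v) w) x)// (near (mulE u v) x)// mulrA.
Unshelve. all: by end_near. Qed.

Let mulC : commutative L0_mul.
Proof.
move=> u v; apply/L0P; near=> x.
by rewrite (near (mulE u v) x)// (near (mulE v u) x)// mulrC.
Unshelve. all: by end_near. Qed.

Let mul1 : left_id L0_one L0_mul.
Proof.
move=> u; apply/L0P; near=> x.
by rewrite (near (mulE L0_one u) x)// (near oneE x)// mul1r.
Unshelve. all: by end_near. Qed.

Let mulD : left_distributive L0_mul +%R.
Proof.
move=> u v w; apply/L0P; near=> x.
rewrite (near (mulE (L0_add u v) w) x)// (near (addE u v) x)//.
rewrite (near (addE (L0_mul u w) (L0_mul v w)) x)//.
by rewrite (near (mulE u w) x)// (near (mulE v w) x)// mulrDl.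
Unshelve. all: by end_near. Qed.

HB.instance Definition _ :=
  GRing.Zmodule_isComPzRing.Build L0 mulA mulC mul1 mulD.

Let scaleA a b u : L0_scale a (L0_scale b u) = L0_scale (a * b) u.
Proof.
apply/L0P; near=> x.
rewrite (near (scaleE a (L0_scale b u)) x)// (near (scaleE b u) x)//.
by rewrite (near (scaleE (a * b) u) x)// mulrA.
Unshelve. all: by end_near. Qed.

Let scale1 : left_id 1 L0_scale.
Proof.
move=> u; apply/L0P; near=> x.
by rewrite (near (scaleE 1 u) x)// mul1r.
Unshelve. all: by end_near. Qed.

Let scaleDr : right_distributive L0_scale +%R.
Proof.
move=> a u v; apply/L0P; near=> x.
rewrite (near (scaleE a (L0_add u v)) x)// (near (addE u v) x)//.
rewrite (near (addE (L0_scale a u) (L0_scale a v)) x)//.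
by rewrite (near (scaleE a u) x)// (near (scaleE a v) x)// mulrDr.
Unshelve. all: by end_near. Qed.

Let scaleDl u : {morph L0_scale^~ u : a b / a + b}.
Proof.
move=> a b; apply/L0P; near=> x.
rewrite (near (scaleE (a + b) u) x)//.
rewrite (near (addE (L0_scale a u) (L0_scale b u)) x)//.
by rewrite (near (scaleE a u) x)// (near (scaleE b u) x)// mulrDl.
Unshelve. all: by end_near. Qed.

HB.instance Definition _ :=
  GRing.Zmodule_isLmodule.Build R L0 scaleA scale1 scaleDr scaleDl.

Definition L0_norm u : L0 := L0_class (Num.norm \o (u : {mfun X >-> R})).
Definition L0_le u v : Prop := \forall x \near F, u x <= v x.
Definition L0_indic (E : set X) (mE : measurable E) : L0 :=
  L0_class (indic_mfun E mE).

Lemma L0_0E : \forall x \near F, (0 : L0) x = 0.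
Proof. exact: L0_classE. Qed.
Lemma L0_1E : \forall x \near F, (1 : L0) x = 1.
Proof. exact: L0_classE. Qed.
Lemma L0_NE u : \forall x \near F, (- u : L0) x = - u x.
Proof. exact: L0_classE. Qed.
Lemma L0_DE u v : \forall x \near F, (u + v : L0) x = u x + v x.
Proof. exact: L0_classE. Qed.
Lemma L0_ME u v : \forall x \near F, (u * v : L0) x = u x * v x.
Proof. exact: L0_classE. Qed.
Lemma L0_ZE (a : R) u : \forall x \near F, (a *: u : L0) x = a * u x.
Proof. exact: L0_classE. Qed.
Lemma L0_normE u : \forall x \near F, L0_norm u x = `|u x|.
Proof. exact: L0_classE. Qed.
Lemma L0_indicE (E : set X) (mE : measurable E) :
  \forall x \near F, L0_indic mE x = \1_E x.
Proof. exact: L0_classE. Qed.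

End L0.
Arguments L0 {d X} R F.

Section sobolev.
Context {d : measure_display} {R : realType} {X : polishBorelType d R}.

(* On 1-Lipschitz curves the integral of [g] with respect to arc length is at
   most [\int g (gamma t) dt], with equality for arc length parametrizations,
   so these curves give the usual inequality along all rectifiable curves. *)
Definition upper_gradient (f : X -> R) (g : X -> \bar R) : Prop :=
  [/\ measurable_fun setT g, (forall x, 0 <= g x)%E &
    forall (L : R) (gamma : R -> X), 0 <= L ->
      {in `[0, L] &, forall s t, mdist (gamma s) (gamma t) <= `|s - t|} ->
      (`|f (gamma L) - f (gamma 0)|%:E <=
        \int[lebesgue_measure]_(t in `[0%R, L]) g (gamma t))%E].

Variable m : {measure set X -> \bar R}.

Definition sqL2 (f : X -> R) : \bar R := (\int[m]_x (f x ^+ 2)%:E)%E.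

(* Cheeger's generalized upper gradients: [G] is an L2 limit of upper gradients
   of functions converging to [f] in L2. The element of least L2 norm is the
   minimal weak upper gradient [|Df|]; its squared norm is the infimum
   [cheeger_energy f], which is how it enters the W12 norm below. *)
Definition weak_upper_gradient (f G : {mfun X >-> R}) : Prop :=
  [/\ (sqL2 f < +oo)%E, (sqL2 G < +oo)%E &
    exists (f_ : nat -> {mfun X >-> R}) (g_ : nat -> X -> \bar R),
      [/\ forall n, upper_gradient (f_ n) (g_ n),
          sqL2 (f_ n - f) @[n --> \oo] --> 0%E &
          (\int[m]_x (`|g_ n x - (G x)%:E| ^+ 2))%E @[n --> \oo] --> 0%E]].

Definition W12 : set {mfun X >-> R} :=
  [set f | exists G, weak_upper_gradient f G].

Definition cheeger_energy (f : {mfun X >-> R}) : \bar R :=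
  ereal_inf [set sqL2 G | G in weak_upper_gradient f].

Definition is_minimal_weak_upper_gradient (f G : {mfun X >-> R}) : Prop :=
  weak_upper_gradient f G /\ sqL2 G = cheeger_energy f.

Definition sqW12 (f : {mfun X >-> R}) : \bar R :=
  (sqL2 f + cheeger_energy f)%E.

Definition capacity (E : set X) : \bar R :=
  ereal_inf [set sqW12 f | f in [set f | W12 f /\
    exists U : set X, [/\ open U, E `<=` U & {ae m, forall x, U x -> 1 <= f x}]]].


Lemma sqL2_ge0 (f : X -> R) : (0 <= sqL2 f)%E.
Proof. by apply: integral_ge0 => x _; rewrite lee_fin sqr_ge0. Qed.

Lemma cheeger_energy_ge0 (f : {mfun X >-> R}) : (0 <= cheeger_energy f)%E.
Proof. by apply: le_ereal_inf_tmp => _ [G _ <-]; exact: sqL2_ge0. Qed.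

Lemma sqW12_ge0 (f : {mfun X >-> R}) : (0 <= sqW12 f)%E.
Proof. by rewrite adde_ge0 ?sqL2_ge0 ?cheeger_energy_ge0. Qed.

Lemma capacity_ge0 (E : set X) : (0 <= capacity E)%E.
Proof. by apply: le_ereal_inf_tmp => _ [f _ <-]; exact: sqW12_ge0. Qed.

Lemma le_capacity (A B : set X) : A `<=` B -> (capacity A <= capacity B)%E.
Proof.
move=> AB; apply: le_ereal_inf_tmp => _ [f [Wf [U [oU BU fU]]] <-].
apply: ereal_inf_lbound; exists f => //; split=> //; exists U; split=> //.
exact: subset_trans BU.
Qed.

Let le_int dT (T : measurableType dT) (mu : {measure set T -> \bar R})
    (D : set T) (f g : T -> \bar R) :
  (forall x, 0 <= f x)%E -> (forall x, f x <= g x)%E ->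
  (\int[mu]_(x in D) f x <= \int[mu]_(x in D) g x)%E.
Proof.
move=> f0 fg; rewrite [leLHS]integral_mkcond [leRHS]integral_mkcond.
have g0 x : (0 <= g x)%E by apply: le_trans (f0 x) (fg x).
have rfg x : ((f \_ D) x <= (g \_ D) x)%E by rewrite /patch; case: ifP.
have rf0 x : (0 <= (f \_ D) x)%E by rewrite /patch; case: ifP.
have rg0 x : (0 <= (g \_ D) x)%E by rewrite /patch; case: ifP.
rewrite !ge0_integralTE//; apply: ereal_sup_le => _ [h hf <-].
by exists h => // x; apply: le_trans (hf x) _.
Qed.

Let cheeger0 : weak_upper_gradient 0 0.
Proof.
have s0 : sqL2 (0 : {mfun X >-> R}) = 0%E.
  by apply: integral0_eq => x _ /=; rewrite expr0n.
split; rewrite ?s0//.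
exists (fun=> 0), (fun=> cst 0%E); split=> [n||].
- split=> /=; [exact: measurable_cst|by []|].
  move=> L gamma L0 _; rewrite subrr normr0.
  by apply: integral_ge0.
- by rewrite (_ : (fun n => _) = cst 0%E); [exact: cvg_cst|
    apply/funext => n; rewrite subrr s0].
- rewrite (_ : (fun n => _) = cst 0%E); first exact: cvg_cst.
  apply/funext => n; apply: integral0_eq => x _ /=.
  by rewrite -[LHS]/(`|0 - (0 : R)%:E| ^+ 2)%E sube0 abse0 expe2 mule0.
Qed.

Lemma capacity0 : capacity set0 = 0%E.
Proof.
apply/eqP; rewrite eq_le capacity_ge0 andbT.
have s0 : sqL2 (0 : {mfun X >-> R}) = 0%E.
  by apply: integral0_eq => x _ /=; rewrite expr0n.
have c0 : cheeger_energy 0 = 0%E.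
  apply/eqP; rewrite eq_le cheeger_energy_ge0 andbT.
  by apply: ereal_inf_lbound; exists 0.
apply: ereal_inf_lbound; exists 0; last by rewrite /sqW12 s0 c0 adde0.
split; first by exists 0.
by exists set0; split=> //; [exact: open0|apply: nearW].
Qed.

Let sqL2_max (f g h : X -> R) : measurable_fun setT f -> measurable_fun setT g ->
  (forall x, `|h x| <= Num.max `|f x| `|g x|) ->
  (sqL2 h <= sqL2 f + sqL2 g)%E.
Proof.
move=> mf mg hfg; rewrite /sqL2 -ge0_integralD//; first last.
- by apply/measurable_EFinP; exact: measurable_funX.
- by move=> x _; rewrite lee_fin sqr_ge0.
- by apply/measurable_EFinP; exact: measurable_funX.
- by move=> x _; rewrite lee_fin sqr_ge0.
apply: le_int => x; first by rewrite lee_fin sqr_ge0.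
rewrite -EFinD lee_fin -real_normK ?num_real//.
rewrite -(real_normK (num_real (f x))) -(real_normK (num_real (g x))).
have := hfg x; rewrite le_max => /orP[] hx.
- by rewrite ler_wpDr ?sqr_ge0// lerXn2r ?nnegrE.
- by rewrite ler_wpDl ?sqr_ge0// lerXn2r ?nnegrE.
Qed.

Let norm_max (a b a' b' : R) :
  `|Num.max a b - Num.max a' b'| <= Num.max `|a - a'| `|b - b'|.
Proof.
have half (x y x' y' p : R) : x - x' <= p -> y - y' <= p ->
    Num.max x y - Num.max x' y' <= p.
  move=> xp yp; rewrite lerBlDr ge_max -!lerBlDl.
  apply/andP; split; rewrite lerBlDl -lerBlDr.
  - by rewrite (le_trans _ xp)// lerB// le_max lexx.
  - by rewrite (le_trans _ yp)// lerB// le_max lexx orbT.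
have hp (x y : R) : x - y <= `|x - y| by rewrite ler_norm.
rewrite ler_norml; apply/andP; split.
- rewrite lerNl opprB; apply: half.
  + by rewrite (le_trans (hp _ _))// distrC le_max lexx.
  + by rewrite (le_trans (hp _ _))// distrC le_max lexx orbT.
- by apply: half; rewrite (le_trans (hp _ _))// le_max lexx ?orbT.
Qed.

Let enorm_max (a b : \bar R) (c e : R) : (0 <= a)%E -> (0 <= b)%E ->
  (`|Order.max a b - (Num.max c e)%:E| ^+ 2 <=
   `|a - c%:E| ^+ 2 + `|b - e%:E| ^+ 2)%E.
Proof.
move=> a0 b0.
have sq0 (x : \bar R) : (0 <= `|x| ^+ 2)%E by rewrite expe2 mule_ge0.
have sqoo (x : R) : (`|+oo - x%:E| ^+ 2 = +oo :> \bar R)%E.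
  by rewrite expe2 /= mulyy.
case: a a0 => [a||] a0 //; last first.
  by rewrite sqoo addye ?leey// -ltNye (lt_le_trans _ (sq0 _)).
case: b b0 => [b||] b0 //; last first.
  by rewrite sqoo addey ?leey// -ltNye (lt_le_trans _ (sq0 _)).
rewrite -EFin_max -!EFinB !abse_EFin -!EFin_expe -EFinD lee_fin.
have := norm_max a b c e; rewrite le_max => /orP[] hx.
- by rewrite ler_wpDr ?sqr_ge0// lerXn2r ?nnegrE.
- by rewrite ler_wpDl ?sqr_ge0// lerXn2r ?nnegrE.
Qed.

Let upper_gradient_max f g u v : upper_gradient f u -> upper_gradient g v ->
  upper_gradient (f \max g) (fun x => maxe (u x) (v x)).
Proof.
move=> [mu u0 fu] [mv v0 gv]; split.
- exact: measurable_maxe.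
- by move=> x; rewrite le_max u0.
- move=> L gamma L0 hg.
  apply: (@le_trans _ _ (Num.max `|f (gamma L) - f (gamma 0)|
                                 `|g (gamma L) - g (gamma 0)|)%:E).
    by rewrite lee_fin norm_max.
  rewrite EFin_max ge_max; apply/andP; split.
  - apply: (le_trans (fu _ _ L0 hg)); apply: le_int => // x.
    by rewrite le_max lexx.
  - apply: (le_trans (gv _ _ L0 hg)); apply: le_int => // x.
    by rewrite le_max lexx orbT.
Qed.

Let sqz (u v w : nat -> \bar R) : (forall n, 0 <= w n)%E ->
  (forall n, w n <= u n + v n)%E ->
  u n @[n --> \oo] --> 0%E -> v n @[n --> \oo] --> 0%E ->
  w n @[n --> \oo] --> 0%E.
Proof.
move=> w0 wuv u0 v0.
apply: (@squeeze_cvge _ _ _ _ (cst 0%E) _ (fun n => u n + v n)%E).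
- by apply: nearW => n; rewrite w0 wuv.
- exact: cvg_cst.
- by rewrite -[X in _ --> X](adde0 0%E); apply: cvgeD.
Qed.

Lemma weak_upper_gradient_max (f g G H : {mfun X >-> R}) :
  weak_upper_gradient f G -> weak_upper_gradient g H ->
  weak_upper_gradient (max_mfun f g) (max_mfun G H).
Proof.
have max_le (a b : R) : `|Num.max a b| <= Num.max `|a| `|b|.
  by have := norm_max a b 0 0; rewrite maxxx !subr0.
move=> [fo Go [f_ [u_ [fu f_f u_G]]]] [go Ho [g_ [v_ [gv g_g v_H]]]].
split.
- apply: le_lt_trans (lte_add_pinfty fo go).
  by apply: sqL2_max => // x; rewrite /= max_le.
- apply: le_lt_trans (lte_add_pinfty Go Ho).
  by apply: sqL2_max => // x; rewrite /= max_le.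
exists (fun n => max_mfun (f_ n) (g_ n)), (fun n x => maxe (u_ n x) (v_ n x)).
split.
- by move=> n; apply: upper_gradient_max.
- apply: sqz f_f g_g => n; first exact: sqL2_ge0.
  apply: sqL2_max => // x; exact: norm_max.
- have mG n : measurable_fun setT (fun x => (`|u_ n x - (G x)%:E| ^+ 2)%E).
    have [mu _ _] := fu n.
    under eq_fun do rewrite expe2.
    by apply: emeasurable_funM; apply: measurableT_comp => //;
      apply: emeasurable_funB => //; exact/measurable_EFinP.
  have mH n : measurable_fun setT (fun x => (`|v_ n x - (H x)%:E| ^+ 2)%E).
    have [mv _ _] := gv n.
    under eq_fun do rewrite expe2.
    by apply: emeasurable_funM; apply: measurableT_comp => //;
      apply: emeasurable_funB => //; exact/measurable_EFinP.
  have sq0 (x : \bar R) : (0 <= `|x| ^+ 2)%E by rewrite expe2 mule_ge0.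
  apply: sqz u_G v_H => n; first by apply: integral_ge0.
  rewrite -ge0_integralD//; apply: le_int => // x.
  have [_ u0 _] := fu n; have [_ v0 _] := gv n.
  exact: enorm_max.
Qed.

Let inf_add (S T : set (\bar R)) (c : \bar R) :
  (forall s, S s -> 0 <= s)%E -> (forall t, T t -> 0 <= t)%E ->
  (forall s, S s -> s < +oo)%E -> (forall t, T t -> t < +oo)%E ->
  (forall s t, S s -> T t -> c <= s + t)%E ->
  (c <= ereal_inf S + ereal_inf T)%E.
Proof.
move=> S0 T0 Soo Too cST.
have iS0 : (0 <= ereal_inf S)%E by apply: le_ereal_inf_tmp.
have iT0 : (0 <= ereal_inf T)%E by apply: le_ereal_inf_tmp.
have [Sy|Sy] := eqVneq (ereal_inf S) +oo%E.
  by rewrite Sy addye ?leey// -ltNye (lt_le_trans _ iT0).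
have Sf : ereal_inf S \is a fin_num by rewrite ge0_fin_numE// ltey.
rewrite addeC -leeBlDr//; apply: le_ereal_inf_tmp => t Tt.
have tf : t \is a fin_num by rewrite ge0_fin_numE ?T0 ?Too.
rewrite leeBlDl// -leeBlDr//; apply: le_ereal_inf_tmp => s Ss.
by rewrite leeBlDr// cST.
Qed.

Let cheeger_energy_max (f g : {mfun X >-> R}) : (cheeger_energy (max_mfun f g) <=
  cheeger_energy f + cheeger_energy g)%E.
Proof.
apply: inf_add => [_ [G _ <-]|_ [G _ <-]|_ [G [] _ ? _ <-]|_ [G [] _ ? _ <-]|
  _ _ [G fG <-] [H gH <-]] //; try exact: sqL2_ge0.
apply: (@le_trans _ _ (sqL2 (max_mfun G H))).
  apply: ereal_inf_lbound; exists (max_mfun G H); last by [].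
  exact: weak_upper_gradient_max.
apply: sqL2_max => // x; have := norm_max (G x) (H x) 0 0.
by rewrite maxxx !subr0.
Qed.

Let W12_fin (f : {mfun X >-> R}) : W12 f -> (sqW12 f < +oo)%E.
Proof.
move=> [G fG]; have [fo Go _] := fG; apply: lte_add_pinfty => //.
by apply: le_lt_trans Go; apply: ereal_inf_lbound; exists G.
Qed.

Lemma capacityU (A B : set X) :
  (capacity (A `|` B) <= capacity A + capacity B)%E.
Proof.
apply: inf_add => [_ [f _ <-]|_ [f _ <-]|_ [f [Wf _] <-]|_ [f [Wf _] <-]|
  _ _ [f [Wf [U [oU AU fU]]] <-] [g [Wg [V [oV BV gV]]] <-]];
  [exact: sqW12_ge0|exact: sqW12_ge0|exact: W12_fin|exact: W12_fin|].
apply: (@le_trans _ _ (sqW12 (max_mfun f g))).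
  apply: ereal_inf_lbound; exists (max_mfun f g) => //; split.
    have [G fG] := Wf; have [H gH] := Wg.
    by exists (max_mfun G H); exact: weak_upper_gradient_max.
  exists (U `|` V); split.
  - exact: openU.
  - exact: setUSS.
  - apply: filterS2 fU gV => x fU gV [Ux|Vx] /=; rewrite le_max.
    + by rewrite fU.
    + by rewrite gV// orbT.
rewrite /sqW12 addeACA; apply: leeD; last exact: cheeger_energy_max.
apply: sqL2_max => // x; have := norm_max (f x) (g x) 0 0.
by rewrite maxxx !subr0.
Qed.

Definition capacity_ae : set_system X := [set P | capacity (~` P) = 0%E].

Lemma capacity_ae_filter : Filter capacity_ae.
Proof.
split.
- by rewrite /capacity_ae/= setCT capacity0.
- move=> P Q P0 Q0; apply/eqP; rewrite eq_le capacity_ge0 andbT setCI.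
  by rewrite (le_trans (capacityU _ _))// P0 Q0 adde0.
- move=> P Q PQ P0; apply/eqP; rewrite eq_le capacity_ge0 andbT.
  by rewrite -P0; apply: le_capacity; exact: subsetC.
Qed.

Lemma capacity_ae_sub : capacity_ae `<=` almost_everywhere m.
Proof.
move=> P /= P0; rewrite /almost_everywhere/=.
have cov (e : R) : 0 < e -> exists U : set X,
    [/\ measurable U, ~` P `<=` U & (m U < e%:E)%E].
  move=> e0; have Pf : capacity (~` P) \is a fin_num by rewrite P0.
  have [_ [f [Wf [U [oU PU fU]]] <-]] := lb_ereal_inf_adherent e0 Pf.
  rewrite -/(capacity _) P0 add0e => fe.
  have mU : measurable U by rewrite borel_measurableE; exact: sub_gen_smallest.
  exists U; split=> //; apply: le_lt_trans fe.
  rewrite -[leLHS]adde0; apply: leeD; last exact: cheeger_energy_ge0.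
  rewrite -(setIT U) -integral_indic// -/(sqL2 f).
  apply: ae_ge0_le_integral => //.
  - exact/measurable_EFinP/measurable_indic.
  - by move=> x _; rewrite lee_fin sqr_ge0.
  - by apply/measurable_EFinP; exact: measurable_funX.
  - apply: filterS fU => x fU _; rewrite lee_fin indicE.
    case: (boolP (x \in U)) => [/set_mem/fU f1|_]; last exact: sqr_ge0.
    by rewrite expr_ge1// (le_trans ler01).
have /choice[U_ hU] (n : nat) : exists U : set X,
    [/\ measurable U, ~` P `<=` U & (m U < (n.+1%:R^-1)%:E)%E].
  exact: cov.
exists (\bigcap_n U_ n); split.
- by apply: bigcap_measurable => // n _; case: (hU n).
- apply/eqP; rewrite eq_le measure_ge0 andbT.
  apply/lee_addgt0Pr => e e0; rewrite add0e.
  have [n ne] : exists n : nat, n.+1%:R^-1 < e.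
    exists (Num.trunc e^-1); rewrite invf_plt ?posrE//.
    by rewrite truncnS_gt// invr_ge0 ltW.
  have [mn _ un] := hU n.
  apply: (@le_trans _ _ (m (U_ n))).
    apply: le_measure; rewrite ?inE//.
      by apply: bigcap_measurable => // k _; case: (hU k).
    by move=> x; exact.
  by apply/ltW/(lt_trans un); rewrite lte_fin.
- by move=> x Px n _; have [_ + _] := hU n; exact.
Qed.

End sobolev.

Section ae_filters.
Context {d : measure_display} {R : realType} {X : polishBorelType d R}.
Variable m : {measure set X -> \bar R}.

Let measure_ae_filter : Filter (almost_everywhere m).
Proof. exact: ae_filter_ringOfSetsType. Qed.

Definition measure_ae_on : filter_on X := FilterType _ measure_ae_filter.
Definition capacity_ae_on : filter_on X :=
  FilterType _ (capacity_ae_filter m).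

End ae_filters.


Section capacity_spaces.
Context {d : measure_display} {R : realType} {X : polishBorelType d R}.
Variable m : {measure set X -> \bar R}.
Local Notation L0m := (L0 R (measure_ae_on m)).
Local Notation L0cap := (L0 R (capacity_ae_on m)).

Definition Pr (g : L0cap) : L0m := L0_class (measure_ae_on m) g.

Lemma Pr_class (g : {mfun X >-> R}) :
  Pr (L0_class (capacity_ae_on m) g) = L0_class (measure_ae_on m) g.
Proof.
apply/L0_classP; apply: capacity_ae_sub.
exact: (L0_classE (capacity_ae_on m) g).
Qed.

Definition choquet (f : X -> R) : \bar R :=
  (\int[@lebesgue_measure R]_(t in `[0%R, +oo[)
    capacity m [set x | (t < f x)%R])%E.

Definition quasi_continuous (f : X -> R) : Prop :=
  forall e : R, 0 < e -> exists E : set X,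
    (capacity m E < e%:E)%E /\ {within ~` E, continuous f}.

Definition QC : set (L0cap) :=
  [set g | exists2 f : X -> R, quasi_continuous f &
    \forall x \near capacity_ae_on m, f x = g x].

(* The graph of QCR: [g] is the quasi-continuous representative of [f]. *)
Definition is_QCR (f : L0m) (g : L0cap) : Prop := QC g /\ Pr g = f.

Definition bounded_subset (B : set X) : Prop :=
  exists (x : X) (r : R), B `<=` ball x r.

Definition finite_on_balls : Prop :=
  forall (x : X) (r : R), (m (ball x r) < +oo)%E.

Definition capacity_exhaustion (A : nat -> set X) : Prop :=
  [/\ forall k, open (A k), forall k, (capacity m (A k) < +oo)%E,
      forall k, A k `<=` A k.+1 &
      forall B, bounded_subset B -> exists k, B `<=` A k].

End capacity_spaces.

Section RCD.
Context {d : measure_display} {R : realType} {X : polishBorelType d R}.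
Variable m : {measure set X -> \bar R}.
Implicit Types mu nu : probability X R.

Definition infinitesimally_hilbertian : Prop :=
  forall f g : {mfun X >-> R}, W12 m f -> W12 m g ->
    (sqW12 m (f + g)%R + sqW12 m (f - g)%R = 2%:E * (sqW12 m f + sqW12 m g))%E.

Definition P2 : set (probability X R) :=
  [set mu | exists x0 : X, (\int[mu]_x (mdist x0 x ^+ 2)%:E < +oo)%E].

Definition coupling mu nu : set (probability (X * X)%type R) :=
  [set pi | forall A : set X, measurable A ->
    pi (A `*` setT) = mu A /\ pi (setT `*` A) = nu A].

Definition sqW2 mu nu : \bar R :=
  ereal_inf [set (\int[pi]_z (mdist z.1 z.2 ^+ 2)%:E)%E | pi in coupling mu nu].

(* The set below has at most one element, because densities are unique almost
   everywhere. It is empty, so that the entropy is [+oo], when [mu] is not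
   absolutely continuous or the positive part of [rho ln rho] is not
   integrable. Note that [ln 0 = 0]. *)
Definition entropy mu : \bar R :=
  ereal_inf [set e | exists rho : {mfun X >-> R},
    [/\ forall x, 0 <= rho x,
        forall E, measurable E -> mu E = (\int[m]_(x in E) (rho x)%:E)%E,
        (\int[m]_x (Num.max (rho x * ln (rho x)) 0)%:E < +oo)%E &
        e = (\int[m]_x (rho x * ln (rho x))%:E)%E]].

Definition W2_geodesic (mu_ : R -> probability X R) mu0 mu1 : Prop :=
  [/\ mu_ 0 =1 mu0, mu_ 1 =1 mu1, {in `[0, 1], forall t, P2 (mu_ t)} &
      {in `[0, 1] &, forall s t,
        sqW2 (mu_ s) (mu_ t) = (((s - t) ^+ 2)%:E * sqW2 mu0 mu1)%E}].

Definition CDoo (K : R) : Prop :=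
  forall mu0 mu1, P2 mu0 -> P2 mu1 ->
    (entropy mu0 < +oo)%E -> (entropy mu1 < +oo)%E ->
    exists2 mu_ : R -> probability X R, W2_geodesic mu_ mu0 mu1 &
      {in `[0, 1], forall t,
        (entropy (mu_ t) <= (1 - t)%:E * entropy mu0 + t%:E * entropy mu1
          - (K / 2 * t * (1 - t))%:E * sqW2 mu0 mu1)%E}.

Definition RCDoo (K : R) : Prop := infinitesimally_hilbertian /\ CDoo K.

End RCD.

(* The topology of the carrier is fixed by [is_L0cap_module] and
   [is_L0m_module] below, which make addition continuous. Joint continuity of
   the real scaling is not required: the distance of an L0(Cap)-module need not
   imply it. For instance, on the real line points have positive capacity, so
   that in L0(Cap) itself [a / x] does not tend to 0 with [a]. *)
Record L0_normed_module {d : measure_display} {X : measurableType d}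
    {R : realType} (F : filter_on X) := L0NormedModule {
  L0m_carrier :> preTopologicalLmodType R;
  L0m_act : L0 R F -> L0m_carrier -> L0m_carrier;
  L0m_norm : L0m_carrier -> L0 R F;
  L0m_actDl : forall f g v, L0m_act (f + g) v = L0m_act f v + L0m_act g v;
  L0m_actDr : forall f v w, L0m_act f (v + w) = L0m_act f v + L0m_act f w;
  L0m_actZl : forall (a : R) f v, L0m_act (a *: f) v = a *: L0m_act f v;
  L0m_actZr : forall (a : R) f v, L0m_act f (a *: v) = a *: L0m_act f v;
  L0m_actA : forall f g v, L0m_act f (L0m_act g v) = L0m_act (f * g) v;
  L0m_act1 : forall v, L0m_act 1 v = v;
  L0m_norm_ge0 : forall v, L0_le 0 (L0m_norm v);
  L0m_norm_eq0 : forall v, L0m_norm v = 0 <-> v = 0;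
  L0m_normD : forall v w, L0_le (L0m_norm (v + w)) (L0m_norm v + L0m_norm w);
  L0m_norm_act : forall f v, L0m_norm (L0m_act f v) = L0_norm f * L0m_norm v
}.

Arguments L0_normed_module {d X} R F.

Section modules.
Context {d : measure_display} {R : realType} {X : polishBorelType d R}.
Variable m : {measure set X -> \bar R}.
Local Notation L0m := (L0 R (measure_ae_on m)).
Local Notation L0cap := (L0 R (capacity_ae_on m)).

Section capacity_module.
Variables (A : nat -> set X) (M : L0_normed_module R (capacity_ae_on m)).

Definition L0cap_dist (v w : M) : \bar R :=
  (\sum_(0 <= k <oo)
    ((2 ^+ k * Num.max (fine (capacity m (A k))) 1)^-1)%:E *
    choquet m (fun x => (\1_(A k) x * Num.min (L0m_norm (v - w) x) 1)%R))%E.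

Definition is_L0cap_module : Prop :=
  (forall (v : M) (U : set M), nbhs v U <->
    exists2 r : R, 0 < r & [set w | (L0cap_dist v w < r%:E)%E] `<=` U) /\
  (forall u : nat -> M,
    (forall e : R, 0 < e -> exists N : nat, forall i j : nat,
      (N <= i)%N -> (N <= j)%N -> (L0cap_dist (u i) (u j) < e%:E)%E) ->
    exists v : M, L0cap_dist (u n) v @[n --> \oo] --> 0%E).

End capacity_module.

Section measure_module.
Variable M : L0_normed_module R (measure_ae_on m).

Definition close_in_measure (B : set X) (e r : R) (v w : M) : Prop :=
  (m (B `&` [set x | (e < L0m_norm (v - w)%R x)%R]) < r%:E)%E.

Definition is_L0m_module : Prop :=
  (forall (v : M) (U : set M), nbhs v U <->
    exists (B : set X) (e r : R),
      [/\ measurable B, bounded_subset B, 0 < e, 0 < r &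
          [set w | close_in_measure B e r v w] `<=` U]) /\
  (forall u : nat -> M,
    (forall (B : set X) (e r : R), measurable B -> bounded_subset B ->
      0 < e -> 0 < r -> exists N : nat, forall i j : nat,
      (N <= i)%N -> (N <= j)%N -> close_in_measure B e r (u i) (u j)) ->
    exists v : M, u n @[n --> \oo] --> v).

Definition L0m_dot (v w : M) : L0m :=
  4^-1 *: (L0m_norm (v + w) ^+ 2 - L0m_norm (v - w) ^+ 2).

Variable grad : L0m -> M.

Definition is_tangent_module : Prop :=
  [/\ is_L0m_module,
      forall (a : R) (f g : L0m), W12 m f -> W12 m g ->
        grad (a *: f + g) = a *: grad f + grad g,
      forall f : L0m, W12 m f ->
        is_minimal_weak_upper_gradient m f (L0m_norm (grad f)) &
      dense [set v : M | exists (n : nat) (E : 'I_n -> set X)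
        (mE : forall i, measurable (E i)) (f : 'I_n -> L0m),
        (forall i, W12 m (f i)) /\
        v = \sum_(i < n) L0m_act (L0_indic _ (mE i)) (grad (f i))]].

Definition is_laplacian (f h : L0m) : Prop :=
  [/\ W12 m f, (sqL2 m h < +oo)%E &
    forall g : L0m, W12 m g ->
      (\int[m]_x (L0m_dot (grad f) (grad g) x)%:E =
        - \int[m]_x (h x * g x)%:E)%E].

Definition ess_bounded (f : L0m) : Prop :=
  exists C : R, {ae m, forall x, `|f x| <= C}.

Definition Test : set (L0m) :=
  [set f | [/\ ess_bounded f,
    exists2 G : L0m, is_minimal_weak_upper_gradient m f G & ess_bounded G &
    exists2 h : L0m, is_laplacian f h & W12 m h]].

End measure_module.

Section tangent_capacity_module.
Variables (A : nat -> set X) (TM : L0_normed_module R (measure_ae_on m)).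
Variable grad : L0m -> TM.
Variable TC : L0_normed_module R (capacity_ae_on m).
Variable gradbar : L0m -> TC.

Definition is_tangent_capacity_module : Prop :=
  [/\ is_L0cap_module A TC,
      forall (a : R) (f g : L0m), Test grad f -> Test grad g ->
        gradbar (a *: f + g) = a *: gradbar f + gradbar g,
      forall f : L0m, Test grad f ->
        exists2 G : L0m, is_minimal_weak_upper_gradient m f G &
          is_QCR G (L0m_norm (gradbar f)) &
      dense [set v : TC | exists (E : nat -> set X)
        (mE : forall n, measurable (E n)) (f : nat -> L0m),
        [/\ trivIset setT E, \bigcup_n E n = setT, forall n, Test grad (f n) &
            forall n, L0m_act (L0_indic _ (mE n)) v =
              L0m_act (L0_indic _ (mE n)) (gradbar (f n))]]].

Definition is_Prbar (P : TC -> TM) : Prop :=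
  [/\ linear P, continuous P,
      forall f : L0m, Test grad f -> P (gradbar f) = grad f &
      forall (g : L0cap) (v : TC), P (L0m_act g v) = L0m_act (Pr g) (P v)].

End tangent_capacity_module.

End modules.

(* Main.v *)
(* Call a pair (s, t) in TC x TM matched if, m-a.e. and locally on countably many
   pieces, s agrees with gradbar f and t with grad f for the same f in Test.
   Minimal weak upper gradients are unique and Test is closed under differences
   (the Laplacian being additive by the parallelogram law of the Dirichlet
   energy), so matched pairs form a subgroup on which |t| = Pr |s|. Convergence
   in TC implies convergence of Pr |.| in measure on bounded sets, because
   m <= Cap; hence the closure of the matched pairs in this sense is the graph of
   an additive map P, total by density in TC and completeness of TM, with
   |P v| = Pr |v|. The rest follows from this isometry, and the graph of any
   admissible operator is contained in the closure, which gives uniqueness. *)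

Require Import Defs.
From HB Require Import structures.
From mathcomp Require Import all_boot all_order all_algebra.
From mathcomp Require Import all_classical all_reals all_analysis.
From mathcomp Require Import measurable_realfun ring lra.
Import Order.TTheory GRing.Theory Num.Theory.
Import numFieldNormedType.Exports.

Set Implicit Arguments.
Unset Strict Implicit.
Unset Printing Implicit Defensive.

Local Open Scope classical_set_scope.
Local Open Scope ring_scope.

(** * Normed modules over L0 *)

Lemma subrACA (V : zmodType) (x y z t : V) : x - y - (z - t) = x - z - (y - t).
Proof. by rewrite !opprB addrACA [RHS]addrACA (addrC (- y)). Qed.

Lemma near_L0_sub_scale1 {d : measure_display} {X : measurableType d} {R : realType}
    {F : filter_on X} (g : L0 R F) (a : R) :
  \forall x \near F, (g - a *: (1 : L0 R F) : L0 R F) x = g x - a.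
Proof.
near=> x; rewrite (near (L0_DE g (- (a *: (1 : L0 R F)))) x)//.
rewrite (near (L0_NE (a *: (1 : L0 R F))) x)// (near (L0_ZE a (1 : L0 R F)) x)//.
by rewrite (near (@L0_1E _ _ R F) x)// mulr1.
Unshelve. all: by end_near. Qed.

Section normed_module.
Context {d : measure_display} {X : measurableType d} {R : realType}.
Context {F : filter_on X} (M : L0_normed_module R F).
Implicit Types (u v w : M) (g : L0 R F).
Local Notation norm := (@L0m_norm _ _ _ _ M).

Lemma L0m_actN g v : L0m_act g (- v) = - L0m_act g v.
Proof. by rewrite -(scaleN1r v) L0m_actZr scaleN1r. Qed.

Lemma L0m_actB g v w : L0m_act g (v - w) = L0m_act g v - L0m_act g w.
Proof. by rewrite L0m_actDr L0m_actN. Qed.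

Lemma L0m_actBl g (h : L0 R F) v : L0m_act (g - h) v = L0m_act g v - L0m_act h v.
Proof.
by rewrite L0m_actDl -(scaleN1r h) L0m_actZl scaleN1r.
Qed.

(** Real scalars act as constant functions, which brings scalar multiples under [L0m_norm_act] and
    later reduces homogeneity to compatibility with the action. *)
Lemma L0m_act_scale (a : R) v : L0m_act (a *: (1 : L0 R F)) v = a *: v.
Proof. by rewrite L0m_actZl L0m_act1. Qed.

Lemma L0m_normN v : norm (- v) = norm v.
Proof.
rewrite -(scaleN1r v) -L0m_act_scale L0m_norm_act; apply/L0P.
near=> x.
rewrite (near (L0_ME (L0_norm (-1 *: (1 : L0 R F))) (norm v)) x)//.
rewrite (near (L0_normE (-1 *: (1 : L0 R F))) x)//.
rewrite (near (L0_ZE (-1) (1 : L0 R F)) x)// (near (@L0_1E _ _ R F) x)//.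
by rewrite mulr1 normrN1 mul1r.
Unshelve. all: by end_near. Qed.

Lemma L0m_norm_sub v w : norm (v - w) = norm (w - v).
Proof. by rewrite -L0m_normN opprB. Qed.

Lemma near_L0m_norm_ge0 v : \forall x \near F, 0 <= norm v x.
Proof.
near=> x; rewrite -(near (@L0_0E _ _ R F) x)//.
exact: (near (L0m_norm_ge0 v) x).
Unshelve. all: by end_near. Qed.

Lemma near_L0m_normD v w : \forall x \near F, norm (v + w) x <= norm v x + norm w x.
Proof.
near=> x; rewrite -(near (L0_DE (norm v) (norm w)) x)//.
exact: (near (L0m_normD v w) x).
Unshelve. all: by end_near. Qed.

Lemma near_L0m_normB v w : \forall x \near F, norm (v - w) x <= norm v x + norm w x.
Proof. by rewrite -(L0m_normN w); exact: near_L0m_normD. Qed.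

Lemma near_L0m_dist_triangle u v w :
  \forall x \near F, norm (u - w) x <= norm (u - v) x + norm (v - w) x.
Proof.
have -> : u - w = (u - v) + (v - w) by rewrite addrA subrK.
exact: near_L0m_normD.
Qed.

Lemma near_L0m_norm_lipschitz v w :
  \forall x \near F, `|norm v x - norm w x| <= norm (v - w) x.
Proof.
near=> x.
have h1 := near (near_L0m_normD (v - w) w) x.
have h2 := near (near_L0m_normD (w - v) v) x.
rewrite ler_norml; apply/andP; split.
- by rewrite lerNl opprB lerBlDr L0m_norm_sub -[X in norm X x <= _](subrK v) h2.
- by rewrite lerBlDr -[X in norm X x <= _](subrK w) h1.
Unshelve. all: by end_near. Qed.

Lemma near_L0m_norm_act g v :
  \forall x \near F, norm (L0m_act g v) x = `|g x| * norm v x.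
Proof.
rewrite L0m_norm_act; near=> x.
rewrite (near (L0_ME (L0_norm g) (norm v)) x)//.
by rewrite (near (L0_normE g) x).
Unshelve. all: by end_near. Qed.

Lemma near_L0m_norm0 : \forall x \near F, norm 0 x = 0.
Proof. by rewrite (L0m_norm_eq0 (0 : M)).2//; exact: L0_0E. Qed.

Lemma eq_L0m_near v w : (\forall x \near F, norm (v - w) x = 0) -> v = w.
Proof.
move=> vw; apply/eqP; rewrite -subr_eq0; apply/eqP/L0m_norm_eq0/L0P.
near=> x; rewrite (near (@L0_0E _ _ R F) x)//; exact: (near vw x).
Unshelve. all: by end_near. Qed.

(** The indicator of [E] annihilates [v - w], so its product with the norm vanishes. This turns the
    partition clauses of the dense set into pointwise statements. *)
Lemma near_L0m_indic_eq (E : set X) (mE : measurable E) v w :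
  L0m_act (L0_indic F mE) v = L0m_act (L0_indic F mE) w ->
  \forall x \near F, E x -> norm (v - w) x = 0.
Proof.
move=> vw; have := near_L0m_norm_act (L0_indic F mE) (v - w).
rewrite L0m_actB vw subrr => vw0; near=> x => Ex.
rewrite -(near near_L0m_norm0 x)// (near vw0 x)//.
by rewrite (near (L0_indicE F mE) x)// indicE mem_set// normr1 mul1r.
Unshelve. all: by end_near. Qed.

Lemma near_L0m_indic_act (E : set X) (mE : measurable E) v :
  \forall x \near F,
    (E x -> norm (L0m_act (L0_indic F mE) v - v) x = 0) /\
    (~ E x -> norm (L0m_act (L0_indic F mE) v) x = 0).
Proof.
have -> : L0m_act (L0_indic F mE) v - v = L0m_act (L0_indic F mE - 1) v.
  by rewrite L0m_actBl L0m_act1.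
near=> x; split => Ex.
  rewrite (near (near_L0m_norm_act (L0_indic F mE - 1) v) x)//.
  rewrite (near (L0_DE (L0_indic F mE) (- 1)) x)// (near (L0_NE (1 : L0 R F)) x)//.
  rewrite (near (L0_indicE F mE) x)// (near (@L0_1E _ _ R F) x)//.
  by rewrite indicE mem_set// subrr normr0 mul0r.
rewrite (near (near_L0m_norm_act (L0_indic F mE) v) x)//.
by rewrite (near (L0_indicE F mE) x)// indicE memNset// normr0 mul0r.
Unshelve. all: by end_near. Qed.

End normed_module.

(** Transfers [ae_foralln] along the countable encoding; integers that decode to nothing carry the
    trivial condition. *)
Lemma ae_forall_countable {d : measure_display} {T : measurableType d} {R : realType}
    (mu : {measure set T -> \bar R}) (I : countType) (P : I -> T -> Prop) :
  (forall i, {ae mu, forall x, P i x}) -> {ae mu, forall x i, P i x}.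
Proof.
move=> Pi; have : {ae mu, forall x (n : nat),
    if unpickle n is Some i then P i x else True}.
  apply/ae_foralln => n; case: (unpickle n) => [i|]; [exact: Pi|exact: nearW].
by apply: filterS => x h i; have := h (pickle i); rewrite pickleK.
Qed.

(** * Capacity and convergence in measure *)

Section capacity_measure.
Context {d : measure_display} {R : realType} {X : polishBorelType d R}.
Variable m : {measure set X -> \bar R}.

Lemma ae_Pr (g : L0 R (capacity_ae_on m)) : {ae m, forall x, Pr g x = g x}.
Proof. exact: (L0_classE (measure_ae_on m)). Qed.

Lemma capacity_ae_measure (P : X -> Prop) :
  (\forall x \near capacity_ae_on m, P x) -> {ae m, forall x, P x}.
Proof. exact: capacity_ae_sub. Qed.

Lemma measurable_open (U : set X) : open U -> measurable U.
Proof. by move=> oU; rewrite borel_measurableE; exact: sub_gen_smallest. Qed.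

Lemma measurable_ball_polish (x : X) (r : R) : measurable (ball x r).
Proof.
have [r0|r0] := ltP 0 r; last first.
  rewrite (_ : ball x r = set0)//; apply/seteqP; split=> y //.
  rewrite ballEmdist/= => h; have := lt_le_trans h r0.
  by rewrite ltNge mdist_ge0.
apply: measurable_open; rewrite openE => y; rewrite ballEmdist/= => xy.
apply/nbhs_ballP; exists (r - mdist x y) => /=; first by rewrite subr_gt0.
move=> z; rewrite !ballEmdist/= ltrBrDl; apply: le_lt_trans.
exact: metric_triangle.
Qed.

(** An admissible [f] is at least 1 a.e. on an open [U] containing [E], so the indicator of [U] is
    at most [f ^+ 2] a.e.; the energy part of the norm is nonnegative. *)
Lemma measure_le_capacity (E : set X) : measurable E -> (m E <= capacity m E)%E.
Proof.
move=> mE; apply: le_ereal_inf_tmp => _ [f [Wf [U [oU EU fU]]] <-].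
have mU := measurable_open oU.
apply: (@le_trans _ _ (m U)); first by apply: le_measure; rewrite ?inE.
rewrite -[leLHS]adde0; apply: leeD; last exact: cheeger_energy_ge0.
rewrite -(setIT U) -integral_indic//.
apply: ae_ge0_le_integral => //.
- exact/measurable_EFinP/measurable_indic.
- by move=> x _; rewrite lee_fin sqr_ge0.
- by apply/measurable_EFinP; exact: measurable_funX.
- apply: filterS fU => x fU _; rewrite lee_fin indicE.
  case: (boolP (x \in U)) => [/set_mem/fU f1|_]; last exact: sqr_ge0.
  by rewrite expr_ge1// (le_trans ler01).
Qed.

(* [t |-> capacity {f > t}] is nonincreasing, so no measurability is needed: the
   lower bound is by a simple function. *)
Lemma choquet_ge (f : X -> R) (e : R) : 0 < e ->
  (e%:E * capacity m [set x | (e <= f x)%R] <= choquet m f)%E.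
Proof.
move=> e0; set c := capacity m _.
have c0 : (0 <= c)%E := capacity_ge0 _ _.
rewrite /choquet.
have -> : (e%:E * c = \int[lebesgue_measure]_(t in `[0%R, e[) c)%E.
  rewrite integral_cst//=.
  rewrite lebesgue_measure_itv/= lte_fin e0 -EFinD subr0 muleC.
  by [].
rewrite [leLHS]integral_mkcond [leRHS]integral_mkcond.
rewrite !ge0_integralTE//; first last.
- by move=> x; rewrite /patch; case: ifP => // _.
- by move=> x; rewrite /patch; case: ifP => // _; exact: capacity_ge0.
apply: ereal_sup_le => _ [h hf <-].
exists h => // x; apply: (le_trans (hf x)).
rewrite /patch; case: ifPn => [|_]; last first.
  by case: ifP => // _; exact: capacity_ge0.
rewrite inE/= in_itv/= => /andP[x0 xe]; rewrite ifT; last first.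
  by rewrite inE/= in_itv/= x0.
apply: le_capacity => y /= ey; exact: lt_le_trans ey.
Qed.

(** The inequality behind [close_in_measure], stated for a bare function so that it also applies to
    norms in the capacitary module. *)
Definition meas_small (B : set X) (e r : R) (u : {mfun X >-> R}) : Prop :=
  (m (B `&` [set x | (e < u x)%R]) < r%:E)%E.

Lemma measurable_fun_gt (B : set X) (e : R) (u : {mfun X >-> R}) : measurable B ->
  measurable (B `&` [set x | e < u x]).
Proof.
move=> mB; have := @measurable_funPT _ _ _ _ u measurableT _ (measurable_itv `]e, +oo[).
rewrite setTI => h; apply: measurableI => //.
rewrite (_ : [set x | _] = u @^-1` `]e, +oo[)//.
by apply/seteqP; split => x/=; rewrite in_itv/= andbT.
Qed.

Lemma measure_ae_le (S T : set X) : measurable S -> measurable T ->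
  {ae m, forall x, S x -> T x} -> (m S <= m T)%E.
Proof.
move=> mS mT [N [mN N0 STN]]; rewrite -[leRHS]adde0 -N0.
apply: le_trans (measureU2 m mT mN).
apply: le_measure; rewrite ?inE//; first exact: measurableU.
move=> x Sx; have [Tx|Tx] := pselect (T x); [by left|right].
by apply: STN => /= /(_ Sx).
Qed.

Lemma meas_small_le (B : set X) (e r : R) (u v : {mfun X >-> R}) : measurable B ->
  {ae m, forall x, u x <= v x} -> meas_small B e r v -> meas_small B e r u.
Proof.
move=> mB uv; apply: le_lt_trans.
apply: measure_ae_le; [exact: measurable_fun_gt|exact: measurable_fun_gt|].
by apply: filterS uv => x uv [Bx eu]; split=> //=; apply: lt_le_trans uv.
Qed.

Lemma meas_small_mono (B B' : set X) (e e' r r' : R) (u : {mfun X >-> R}) :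
  measurable B -> measurable B' -> B `<=` B' -> e' <= e -> r' <= r ->
  meas_small B' e' r' u -> meas_small B e r u.
Proof.
move=> mB mB' BB' e'e r'r; rewrite /meas_small => h.
apply: lt_le_trans (_ : (r'%:E <= r%:E)%E); last by rewrite lee_fin.
apply: le_lt_trans h; apply: le_measure; rewrite ?inE.
- exact: measurable_fun_gt.
- exact: measurable_fun_gt.
- by move=> x [Bx eu]; split; [exact: BB'|apply: le_lt_trans eu].
Qed.

(** Triangle inequality for convergence in measure: where the sum exceeds [e], one of the summands
    exceeds [e / 2]. *)
Lemma meas_small_add (B : set X) (e r : R) (u v w : {mfun X >-> R}) : measurable B ->
  {ae m, forall x, u x <= v x + w x} ->
  meas_small B (e / 2) (r / 2) v -> meas_small B (e / 2) (r / 2) w ->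
  meas_small B e r u.
Proof.
move=> mB uvw sv sw; rewrite /meas_small.
apply: (@le_lt_trans _ _ (m ((B `&` [set x | e / 2 < v x]) `|`
  (B `&` [set x | e / 2 < w x])))).
  apply: measure_ae_le; [exact: measurable_fun_gt| |].
    by apply: measurableU; exact: measurable_fun_gt.
  apply: filterS uvw => x uvw [Bx /= eu].
  have [ve|ev] := leP (v x) (e / 2); last by left.
  right; split=> //=; rewrite ltNge; apply/negP => we.
  by move: (lt_le_trans eu (le_trans uvw (lerD ve we))); rewrite -splitr ltxx.
apply: le_lt_trans (measureU2 m _ _) _; [exact: measurable_fun_gt..|].
by rewrite (splitr r) EFinD; apply: lteD.
Qed.

Lemma ex_invSn_lt (e : R) : 0 < e -> exists k : nat, k.+1%:R^-1 < e.
Proof.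
move=> e0; exists (Num.truncn e^-1); rewrite invf_plt ?posrE//.
by rewrite truncnS_gt// invr_ge0 ltW.
Qed.

(** The set where [u] is positive is a countable union, over integer radii and levels [k.+1%:R^-1],
    of sets in balls whose measure is below every positive [r]. *)
Lemma ae_le0_of_meas_small (u : {mfun X >-> R}) :
  (forall B e r, measurable B -> bounded_subset B -> 0 < e -> 0 < r ->
    meas_small B e r u) -> {ae m, forall x, u x <= 0}.
Proof.
move=> us; have [[x0 _]|X0] := pselect (exists x0 : X, True); last first.
  by apply: nearW => x; exfalso; apply: X0; exists x.
have : {ae m, forall x (nk : nat * nat),
    ~ (ball x0 nk.1%:R `&` [set x | nk.2.+1%:R^-1 < u x]) x}.
  apply: ae_forall_countable => -[n k] /=.
  exists (ball x0 n%:R `&` [set x | k.+1%:R^-1 < u x]); split.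
  - apply: measurable_fun_gt; exact: measurable_ball_polish.
  - apply/eqP; rewrite eq_le measure_ge0 andbT.
    apply/lee_addgt0Pr => r r0; rewrite add0e; apply/ltW/us => //.
    + exact: measurable_ball_polish.
    + by exists x0, n%:R.
  - by move=> x /= /contrapT.
apply: filterS => x h; rewrite leNgt; apply/negP => ux.
have [k ke] := ex_invSn_lt ux.
apply: (h ((Num.truncn (mdist x0 x)).+1, k)) => /=; split=> //.
by rewrite ballEmdist/= truncnS_gt// mdist_ge0.
Qed.

(** Continuity from above: the remainders of [B] decrease to the empty set, and [B] has finite
    measure. *)
Lemma measure_tail (B : set X) (E : nat -> set X) (r : R) :
  measurable B -> (m B < +oo)%E -> (forall n, measurable (E n)) ->
  \bigcup_n E n = setT -> 0 < r ->
  exists N, (m (B `\` \big[setU/set0]_(n < N) E n) < r%:E)%E.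
Proof.
move=> mB Bfin mE ET r0.
pose F N := B `\` \big[setU/set0]_(n < N) E n.
have mF N : measurable (F N).
  by apply: measurableD => //; apply: bigsetU_measurable => *; exact: mE.
have F0 : \bigcap_N F N = set0.
  apply/seteqP; split=> // x Fx; have [n _ Enx] : (\bigcup_n E n) x by rewrite ET.
  have [_] := Fx n.+1 I; apply; rewrite big_ord_recr/=; by right.
have : m \o F @ \oo --> m (\bigcap_N F N).
  apply: nonincreasing_cvg_mu => //.
  - by rewrite /F big_ord0 setD0.
  - by rewrite F0.
  - apply/nonincreasing_seqP => N; apply/subsetPset; rewrite /F big_ord_recr/=.
    by apply: setDS; exact: subsetUl.
rewrite F0 measure0 => /fine_cvgP[Ffin Fcvg].
have [N _ hN] := (Ffin).
have := cvgr_lt (0 : R) Fcvg r r0 => -[N' _ hN'].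
exists (maxn N N'); have := hN (maxn N N') (leq_maxl _ _) => /= fF.
have := hN' (maxn N N') (leq_maxr _ _) => /= lF.
by rewrite -(fineK fF) lte_fin.
Qed.

End capacity_measure.

(** * Matched pairs and their closure *)

Section matched.
Context {d : measure_display} {R : realType} {X : polishBorelType d R}.
Variable m : {measure set X -> \bar R}.
Variables (TM : L0_normed_module R (measure_ae_on m)).
Variables (TC : L0_normed_module R (capacity_ae_on m)).
Local Notation L0m := (L0 R (measure_ae_on m)).
Local Notation L0cap := (L0 R (capacity_ae_on m)).
Variables (grad : L0m -> TM) (gradbar : L0m -> TC) (T : set L0m).
Hypothesis TB : forall f g, T f -> T g -> T (f - g).
Hypothesis gradB : forall f g, T f -> T g -> grad (f - g) = grad f - grad g.
Hypothesis gradbarB :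
  forall f g, T f -> T g -> gradbar (f - g) = gradbar f - gradbar g.
Hypothesis grad_norm :
  forall f, T f -> {ae m, forall x, L0m_norm (grad f) x = L0m_norm (gradbar f) x}.
Hypothesis T_neq0 : T !=set0.
Implicit Types (s v : TC) (t w : TM).

(** Leaving the index type free lets each construction choose its own: a product for differences,
    [bool] for a cut-off. Both norms are read m-a.e., although [s] lives in the finer module. *)
Definition matched s t : Prop := exists (I : countType) (f : I -> L0m),
  (forall i, T (f i)) /\
  {ae m, forall x, exists i,
    L0m_norm (s - gradbar (f i)) x = 0 /\ L0m_norm (t - grad (f i)) x = 0}.

Lemma matched_grad f : T f -> matched (gradbar f) (grad f).
Proof.
move=> Tf; exists unit, (fun=> f); split=> //.
have h1 := capacity_ae_measure (near_L0m_norm0 TC).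
have h2 := near_L0m_norm0 TM.
by apply: filterS2 h1 h2 => x h1 h2; exists tt; rewrite !subrr.
Qed.

(** Common refinement: where piece [i] of the first pair meets piece [j] of the second, the test
    function [f i - g j] serves. *)
Lemma matchedB s s' t t' : matched s t -> matched s' t' ->
  matched (s - s') (t - t').
Proof.
move=> [I [f [Tf fst]]] [J [g [Tg gst]]].
exists (I * J)%type, (fun ij => f ij.1 - g ij.2); split.
  by move=> ij; exact: TB.
have hC : {ae m, forall x (ij : I * J),
    0 <= L0m_norm (s - s' - gradbar (f ij.1 - g ij.2)) x <=
    L0m_norm (s - gradbar (f ij.1)) x + L0m_norm (s' - gradbar (g ij.2)) x}.
  apply: ae_forall_countable => ij; apply: capacity_ae_measure.
  rewrite gradbarB// subrACA.
  have := near_L0m_normB (s - gradbar (f ij.1)) (s' - gradbar (g ij.2)).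
  apply: filterS2 (near_L0m_norm_ge0 _) => x h1 h2.
  by apply/andP; split; [exact: h1|exact: h2].
have hM : {ae m, forall x (ij : I * J),
    0 <= L0m_norm (t - t' - grad (f ij.1 - g ij.2)) x <=
    L0m_norm (t - grad (f ij.1)) x + L0m_norm (t' - grad (g ij.2)) x}.
  apply: ae_forall_countable => ij; rewrite gradB// subrACA.
  have := near_L0m_normB (t - grad (f ij.1)) (t' - grad (g ij.2)).
  apply: filterS2 (near_L0m_norm_ge0 _) => x h1 h2.
  by apply/andP; split; [exact: h1|exact: h2].
apply: filterS2 (filterI fst gst) (filterI hC hM) => x.
move=> [[i [si ti]] [j [sj tj]]] [hCx hMx].
exists (i, j) => /=; split; apply/eqP; rewrite eq_le andbC.
- by have := hCx (i, j); rewrite /= si sj addr0.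
- by have := hMx (i, j); rewrite /= ti tj addr0.
Qed.

Lemma matched0 : matched 0 0.
Proof.
have [f Tf] := T_neq0; have := matchedB (matched_grad Tf) (matched_grad Tf).
by rewrite !subrr.
Qed.

Lemma matchedD s s' t t' : matched s t -> matched s' t' ->
  matched (s + s') (t + t').
Proof.
move=> st st'; rewrite -(opprK s') -(opprK t') -(sub0r s') -(sub0r t').
exact: matchedB (matchedB matched0 st').
Qed.

(** At almost every point both norms equal those of the two gradients of one and the same test
    function, where they coincide. *)
Lemma matched_norm s t : matched s t ->
  {ae m, forall x, L0m_norm t x = L0m_norm s x}.
Proof.
move=> [I [f [Tf fst]]].
have hC : {ae m, forall x i, `|L0m_norm s x - L0m_norm (gradbar (f i)) x| <=
    L0m_norm (s - gradbar (f i)) x}.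
  apply: ae_forall_countable => i; apply: capacity_ae_measure.
  exact: near_L0m_norm_lipschitz.
have hM : {ae m, forall x i, `|L0m_norm t x - L0m_norm (grad (f i)) x| <=
    L0m_norm (t - grad (f i)) x}.
  by apply: ae_forall_countable => i; exact: (near_L0m_norm_lipschitz t (grad (f i))).
have hN : {ae m, forall x i,
    L0m_norm (grad (f i)) x = L0m_norm (gradbar (f i)) x}.
  by apply: ae_forall_countable => i; exact: grad_norm.
apply: filterS2 (filterI fst hN) (filterI hC hM) => x.
move=> [[i [si ti]] hNx] [/(_ i) + /(_ i)].
by rewrite si ti !normr_le0 !subr_eq0 => /eqP -> /eqP ->.
Qed.

Lemma matched_indic (E : set X) (mE : measurable E) f : T f ->
  matched (L0m_act (L0_indic _ mE) (gradbar f)) (L0m_act (L0_indic _ mE) (grad f)).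
Proof.
(* Off [E] both elements vanish, and zero is the gradient of the test function [f - f]. *)
move=> Tf; exists bool, (fun b => if b then f else f - f); split.
  by case=> //; exact: TB.
have h1 := capacity_ae_measure (near_L0m_indic_act mE (gradbar f)).
have h2 := near_L0m_indic_act (F := measure_ae_on m) mE (grad f).
apply: filterS2 h1 h2 => x [C1 C2] [M1 M2].
have [Ex|Ex] := pselect (E x).
  by exists true; rewrite C1// M1.
by exists false; rewrite gradB// gradbarB// !subrr !subr0 C2// M2.
Qed.

(* The matched pairs are closed up with respect to convergence of the norms in
   m-measure on bounded sets, also in the capacitary module TC. *)
Definition approx_matched v w : Prop := forall B e r,
  measurable B -> bounded_subset B -> 0 < e -> 0 < r ->
  exists s t, [/\ matched s t, meas_small m B e r (L0m_norm (v - s)) &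
    meas_small m B e r (L0m_norm (w - t))].

Lemma approx_matched_matched s t : matched s t -> approx_matched s t.
Proof.
move=> st B e r mB bB e0 r0; exists s, t; rewrite !subrr.
have small0 (u : {mfun X >-> R}) : {ae m, forall x, u x = 0} -> meas_small m B e r u.
  move=> u0; apply: (@meas_small_le _ _ _ _ _ _ _ _ 0) => //.
    by apply: filterS u0 => x ->.
  rewrite /meas_small (_ : _ `&` _ = set0) ?measure0 ?lte_fin//.
  by apply/seteqP; split=> x // [_ /=]; rewrite ltNge ltW.
split=> //; apply: small0.
  exact: capacity_ae_measure (near_L0m_norm0 TC).
exact: (near_L0m_norm0 TM).
Qed.

Lemma approx_matchedB v v' w w' : approx_matched v w -> approx_matched v' w' ->
  approx_matched (v - v') (w - w').
Proof.
move=> vw vw' B e r mB bB e0 r0.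
have e2 : 0 < e / 2 by rewrite divr_gt0.
have r2 : 0 < r / 2 by rewrite divr_gt0.
have [s [t [st vs wt]]] := vw _ _ _ mB bB e2 r2.
have [s' [t' [st' vs' wt']]] := vw' _ _ _ mB bB e2 r2.
exists (s - s'), (t - t'); split; first exact: matchedB.
- rewrite subrACA; apply: meas_small_add vs vs' => //.
  exact: capacity_ae_measure (near_L0m_normB _ _).
- rewrite subrACA; apply: meas_small_add wt wt' => //.
  exact: (near_L0m_normB (F := measure_ae_on m)).
Qed.

(** For any matched pair [s], [t] the norms of [v] and [w] differ by at most the norm of [v - s]
    plus that of [w - t], and these can be made small in measure on every bounded set. *)
Lemma approx_matched_norm v w : approx_matched v w ->
  {ae m, forall x, L0m_norm w x = L0m_norm v x}.
Proof.
move=> vw.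
have bound (p q : {mfun X >-> R}) :
    (forall s t, matched s t -> {ae m, forall x, p x - q x <=
      L0m_norm (v - s) x + L0m_norm (w - t) x}) ->
    {ae m, forall x, p x <= q x}.
  move=> pq; suff : {ae m, forall x, (p - q) x <= 0}.
    by apply: filterS => x /=; rewrite subr_le0.
  apply: ae_le0_of_meas_small => B e r mB bB e0 r0.
  have e2 : 0 < e / 2 by rewrite divr_gt0.
  have r2 : 0 < r / 2 by rewrite divr_gt0.
  have [s [t [st vs wt]]] := vw _ _ _ mB bB e2 r2.
  by apply: meas_small_add vs wt => //; exact: pq.
have key s t : matched s t -> {ae m, forall x,
    `|L0m_norm w x - L0m_norm v x| <= L0m_norm (v - s) x + L0m_norm (w - t) x}.
  move=> /matched_norm st.
  have h1 := capacity_ae_measure (near_L0m_norm_lipschitz v s).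
  have h2 := near_L0m_norm_lipschitz w t.
  apply: filterS2 (filterI h1 h2) st => x [h1x h2x] st.
  rewrite (_ : _ - _ = (L0m_norm w x - L0m_norm t x) -
    (L0m_norm v x - L0m_norm s x)); last by rewrite st; ring.
  by rewrite [leRHS]addrC; apply: le_trans (ler_normB _ _) _; apply: lerD.
have h1 : {ae m, forall x, L0m_norm w x <= L0m_norm v x}.
  apply: bound => s t /key; apply: filterS => x; apply: le_trans.
  exact: ler_norm.
have h2 : {ae m, forall x, L0m_norm v x <= L0m_norm w x}.
  apply: bound => s t /key; apply: filterS => x; apply: le_trans.
  by rewrite distrC ler_norm.
by apply: filterS2 h1 h2 => x h1 h2; apply/eqP; rewrite eq_le h1.
Qed.

(** The difference of the two pairs is 0 in [TC] paired with [w - w'], which then has zero norm. *)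
Lemma approx_matched_fun v w w' :
  approx_matched v w -> approx_matched v w' -> w = w'.
Proof.
move=> vw vw'; apply: eq_L0m_near.
have := approx_matched_norm (approx_matchedB vw vw'); rewrite subrr => h.
have h0 := capacity_ae_measure (near_L0m_norm0 TC).
by apply: filterS2 h h0 => x -> ->.
Qed.

(** * Capacitary neighbourhoods, density and completeness *)

Hypothesis finm : finite_on_balls m.
Variable A : nat -> set X.
Hypothesis exhA : capacity_exhaustion m A.
Hypothesis modC : is_L0cap_module A TC.
Hypothesis modM : is_L0m_module TM.
Hypothesis denseC : dense [set v : TC | exists (E : nat -> set X)
  (mE : forall n, measurable (E n)) (f : nat -> L0m),
  [/\ trivIset setT E, \bigcup_n E n = setT, forall n, T (f n) &
    forall n, L0m_act (L0_indic _ (mE n)) v =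
      L0m_act (L0_indic _ (mE n)) (gradbar (f n))]].

(** Capacitary convergence is stronger than convergence in measure: one term of the series defining
    the distance controls the capacity of the set where the norm is large inside [A k], and capacity
    dominates measure. *)
Lemma nbhs_meas_small v B e r : measurable B -> bounded_subset B ->
  0 < e -> 0 < r -> nbhs v [set s | meas_small m B e r (L0m_norm (v - s))].
Proof.
move=> mB bB e0 r0; apply/(modC.1).
have [oA _ _ /(_ _ bB)[k BA]] := exhA.
pose c : R := (2 ^+ k * Num.max (fine (capacity m (A k))) 1)^-1.
have c0 : 0 < c by rewrite invr_gt0 mulr_gt0// ?exprn_gt0// lt_max ltr01 orbT.
pose e' := Num.min e 1.
have e'0 : 0 < e' by rewrite lt_min e0 ltr01.
(* [c] is the weight of the k-th term. The Chebyshev bound at level [e'] turns a distance below this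
   radius into a capacity below [r]; [e'] is capped at 1 because the distance truncates the norm
   there. *)
exists (c * (e' * r)); first by rewrite !mulr_gt0.
move=> s /= dvs; rewrite /meas_small.
pose f := fun x => (\1_(A k) x * Num.min (L0m_norm (v - s) x) 1)%R.
have chf0 (g : X -> R) : (0 <= choquet m g)%E.
  by apply: integral_ge0 => t _; exact: capacity_ge0.
have : (c%:E * choquet m f < (c * (e' * r))%:E)%E.
  apply: le_lt_trans dvs.
  set u : nat -> \bar R := (fun k =>
    ((2 ^+ k * Num.max (fine (capacity m (A k))) 1)^-1)%:E *
    choquet m (fun x => (\1_(A k) x * Num.min (L0m_norm (v - s) x) 1)%R))%E.
  have u0 n : (0 <= u n)%E.
    by rewrite mule_ge0// lee_fin invr_ge0 mulr_ge0// ?exprn_ge0// le_max ler01 orbT.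
  apply: (@le_trans _ _ (\sum_(0 <= i < k.+1) u i)%E).
    by rewrite big_nat_recr//= leeDr// sume_ge0.
  exact: nneseries_lim_ge.
rewrite EFinM lte_pmul2l//; move=> /(le_lt_trans (choquet_ge m f e'0)).
rewrite EFinM lte_pmul2l//; apply: le_lt_trans.
have mAk : measurable (A k) by exact: measurable_open.
apply: (@le_trans _ _ (m (A k `&` [set x | e < L0m_norm (v - s) x]))).
  apply: le_measure; rewrite ?inE; [exact: measurable_fun_gt..|exact: setSI].
apply: le_trans (measure_le_capacity _ _) _; first exact: measurable_fun_gt.
apply: le_capacity => x [Akx /= ex].
by rewrite /f indicE mem_set// mul1r le_min2// ltW.
Qed.

(** Compatibility with the action carries the identity between [s] and [gradbar (f n)] on [E n] to
    one between [P s] and [grad (f n)] on the same piece. *)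
Lemma matched_projection (P : TC -> TM) s (E : nat -> set X)
    (mE : forall n, measurable (E n)) (f : nat -> L0m) :
  linear P -> (forall f, T f -> P (gradbar f) = grad f) ->
  (forall (g : L0cap) (v : TC), P (L0m_act g v) = L0m_act (Pr g) (P v)) ->
  \bigcup_n E n = setT -> (forall n, T (f n)) ->
  (forall n, L0m_act (L0_indic _ (mE n)) s =
      L0m_act (L0_indic _ (mE n)) (gradbar (f n))) -> matched s (P s).
Proof.
move=> lP Pf Pact ET Tf sf; exists nat, f; split=> //.
have hC : {ae m, forall x n, E n x -> L0m_norm (s - gradbar (f n)) x = 0}.
  apply: ae_forall_countable => n; apply: capacity_ae_measure.
  exact: (near_L0m_indic_eq (sf n)).
have hM : {ae m, forall x n, E n x -> L0m_norm (P s - grad (f n)) x = 0}.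
  apply: ae_forall_countable => n.
  apply: (near_L0m_indic_eq (F := measure_ae_on m) (mE := mE n)).
  rewrite -[L0_indic (measure_ae_on m) _]Pr_class -Pact sf Pact Pf//.
apply: filterS2 hC hM => x hC hM.
have [n _ Enx] : (\bigcup_n E n) x by rewrite ET.
by exists n; split; [exact: hC|exact: hM].
Qed.

(** The uniqueness half: continuity of [P] and density provide a piecewise gradient [s] with [v - s]
    and [P v - P s] both small in measure. *)
Lemma approx_matched_projection (P : TC -> TM) v :
  linear P -> continuous P -> (forall f, T f -> P (gradbar f) = grad f) ->
  (forall (g : L0cap) (v : TC), P (L0m_act g v) = L0m_act (Pr g) (P v)) ->
  approx_matched v (P v).
Proof.
move=> lP cP Pf Pact B e r mB bB e0 r0.
have nP : nbhs v (P @^-1` [set t | close_in_measure B e r (P v) t]).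
  by apply: cP; apply/(modM.1); exists B, e, r; split.
have : nbhs v ([set s | meas_small m B e r (L0m_norm (v - s))] `&`
    P @^-1` [set t | close_in_measure B e r (P v) t]).
  by apply: filterI => //; exact: nbhs_meas_small.
rewrite nbhsE /= => -[U [oU Uv] UBP].
have [s [Us [E [mE [f [_ ET Tf sf]]]]]] := denseC (ex_intro _ _ Uv) oU.
have [vs Pvs] := UBP _ Us.
exists s, (P s); split=> //; exact: matched_projection sf.
Qed.

(** A partner in [TM] for the whole of [s] would be an infinite sum; keeping the first [N] pieces
    leaves finite sums, which are matched by additivity. *)
Lemma matched_truncation s (E : nat -> set X) (mE : forall n, measurable (E n))
    (f : nat -> L0m) N :
  trivIset setT E -> (forall n, T (f n)) ->
  (forall n, L0m_act (L0_indic _ (mE n)) s =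
      L0m_act (L0_indic _ (mE n)) (gradbar (f n))) ->
  exists s' t', matched s' t' /\
    {ae m, forall x, (\big[setU/set0]_(n < N) E n) x -> L0m_norm (s - s') x = 0}.
Proof.
move=> tE Tf sf.
(* The induction also records that [s'] vanishes off the first [N] pieces; with disjointness, the
   next piece can then be added without disturbing the earlier ones. *)
suff [s' [t' [st h]]] : exists s' t', matched s' t' /\ {ae m, forall x,
    (forall n, (n < N)%N -> E n x -> L0m_norm (s - s') x = 0) /\
    ((forall n, (n < N)%N -> ~ E n x) -> L0m_norm s' x = 0)}.
  exists s', t'; split=> //; apply: filterS h => x [h _].
  by rewrite -bigcup_mkord => -[n /= nN Enx]; exact: (h n).
elim: N => [|N [s' [t' [st h]]]].
  exists 0, 0; split; first exact: matched0.
  by apply: filterS (capacity_ae_measure (near_L0m_norm0 TC)) => x; split.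
exists (s' + L0m_act (L0_indic _ (mE N)) (gradbar (f N))).
exists (t' + L0m_act (L0_indic _ (mE N)) (grad (f N))).
split; first by apply: matchedD => //; exact: matched_indic.
set g := gradbar (f N); set cg := L0m_act _ g.
have hg := capacity_ae_measure (near_L0m_indic_act (mE N) g).
have hs := capacity_ae_measure (near_L0m_indic_eq (sf N)).
have h0 := capacity_ae_measure (near_L0m_norm_ge0 (s' + cg)).
have h1 := capacity_ae_measure (near_L0m_normD s' cg).
have h2 := capacity_ae_measure (near_L0m_norm_ge0 (s - (s' + cg))).
have h3 := capacity_ae_measure (near_L0m_normB (s - s') cg).
have h4 := capacity_ae_measure (near_L0m_normB (s - cg) s').
have h5 := capacity_ae_measure (near_L0m_dist_triangle s g cg).
have e1 : s - (s' + cg) = s - s' - cg by rewrite opprD addrA.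
have e2 : s - (s' + cg) = s - cg - s' by rewrite opprD addrCA addrC addrAC.
rewrite -e1 in h3; rewrite -e2 in h4.
rewrite (L0m_norm_sub g cg) in h5.
apply: filterS2 (filterI (filterI h hg) (filterI hs h0))
  (filterI (filterI h1 h2) (filterI h3 (filterI h4 h5))) => x.
move=> [[[hx1 hx2] [hg1 hg2]] [hsx h0x]] [[h1x h2x] [h3x [h4x h5x]]].
have disj n : (n < N)%N -> E N x -> ~ E n x.
  move=> nN ENx Enx; have := tE n N I I.
  by move=> /(_ (ex_intro _ x (conj Enx ENx))) nNE; rewrite nNE ltnn in nN.
split=> [n|Ex].
  rewrite ltnS leq_eqVlt => /orP[/eqP ->|nN] Enx; apply/eqP; rewrite eq_le h2x andbT.
    apply: (le_trans h4x); rewrite (hx2 _) ?addr0; last by move=> k kN; exact: disj.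
    by apply: (le_trans h5x); rewrite hsx// hg1// addr0.
  apply: (le_trans h3x); rewrite (hx1 n)// add0r hg2//.
  by move=> /(disj n nN).
apply/eqP; rewrite eq_le h0x andbT; apply: (le_trans h1x).
rewrite hg2 ?addr0; last exact: Ex.
by rewrite hx2// => n nN; apply: Ex; rewrite ltnW.
Qed.

(** Half of the tolerance is spent on density, the other half on truncation: the part of [B] outside
    the first [N] pieces has small measure, since [B] lies in a ball of finite measure. *)
Lemma matched_approx v B e r : measurable B -> bounded_subset B ->
  0 < e -> 0 < r -> exists s t, matched s t /\ meas_small m B e r (L0m_norm (v - s)).
Proof.
move=> mB bB e0 r0.
have e2 : 0 < e / 2 by rewrite divr_gt0.
have r2 : 0 < r / 2 by rewrite divr_gt0.
have := nbhs_meas_small v mB bB e2 r2.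
rewrite nbhsE /= => -[U [oU Uv] UB].
have [s [Us [E [mE [f [tE ET Tf sf]]]]]] := denseC (ex_intro _ _ Uv) oU.
have Bfin : (m B < +oo)%E.
  have [x0 [rho Bb]] := bB; apply: le_lt_trans (finm x0 rho).
  by apply: le_measure; rewrite ?inE//; exact: measurable_ball_polish.
have [N BN] := measure_tail mB Bfin mE ET r2.
have [s' [t' [st ss']]] := matched_truncation N tE Tf sf.
exists s', t'; split=> //; apply: meas_small_add (UB _ Us) _ => //.
  exact: capacity_ae_measure (near_L0m_dist_triangle v s s').
apply: le_lt_trans BN; apply: measure_ae_le.
- exact: measurable_fun_gt.
- by apply: measurableD => //; apply: bigsetU_measurable => *; exact: mE.
- apply: filterS ss' => x ss' [Bx /= ex]; split=> //.
  by move=> /ss' s0; move: ex; rewrite s0 ltNge ltW.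
Qed.

(** Approximants [s_ j] of [v] on growing balls have partners [t_ j]. Differences of partners have
    the norms of differences of approximants, so [t_] is Cauchy and its limit is the value at
    [v]. *)
Lemma approx_matched_total v : exists w, approx_matched v w.
Proof.
(* The space is nonempty: a basic neighbourhood in [TM] comes with a bounded set, hence with a
   centre. *)
have [x0 _] : exists x0 : X, True.
  have [B [e [r [_ [x0 _] _ _ _]]]] := (modM.1 0 setT).1 filterT.
  by exists x0.
pose B (j : nat) : set X := ball x0 j%:R.
have mB j : measurable (B j) by exact: measurable_ball_polish.
have bB j : bounded_subset (B j) by exists x0, j%:R.
have inv0 (j : nat) : 0 < j.+1%:R^-1 :> R by rewrite invr_gt0.
have /choice[s_ /choice[t_ st_]] : forall j : nat, exists s t, matched s t /\
    meas_small m (B j) j.+1%:R^-1 j.+1%:R^-1 (L0m_norm (v - s)).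
  by move=> j; exact: matched_approx.
have small D e r : bounded_subset D -> 0 < e -> 0 < r -> measurable D ->
    exists N : nat, forall j, (N <= j)%N -> meas_small m D e r (L0m_norm (v - s_ j)).
  move=> [x [rho Drho]] e0 r0 mD.
  have er0 : 0 < Num.min e r by rewrite lt_min e0.
  have [k] := ex_invSn_lt er0; rewrite lt_min => /andP[ke kr].
  (* By the triangle inequality this radius makes the ball around [x0] contain the given ball around
     [x]. *)
  pose n := (Num.truncn (mdist x0 x + `|rho|)).+1.
  exists (maxn k n) => j; rewrite geq_max => /andP[kj nj].
  have kj' : j.+1%:R^-1 <= k.+1%:R^-1 :> R.
    by rewrite lef_pV2 ?posrE// ler_nat.
  apply: (@meas_small_mono _ _ _ m D (B j)) (st_ j).2 => //.
  - move=> y /Drho; rewrite /B !ballEmdist/= => xy.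
    apply: le_lt_trans (metric_triangle _ x _) _.
    apply: (@lt_le_trans _ _ n%:R); last by rewrite ler_nat.
    apply: lt_trans (_ : _ < mdist x0 x + `|rho|) _; last first.
      by rewrite truncnS_gt// addr_ge0// mdist_ge0.
    by rewrite ltrD2l (lt_le_trans xy)// ler_norm.
  - by rewrite (le_trans kj')// ltW.
  - by rewrite (le_trans kj')// ltW.
have [w tw] : exists w : TM, t_ n @[n --> \oo] --> w.
  apply: (modM.2) => D e r mD bD e0 r0.
  have [N hN] := small D _ _ bD (divr_gt0 e0 (ltr0Sn _ 1)) (divr_gt0 r0 (ltr0Sn _ 1)) mD.
  exists N => i j Ni Nj; apply: meas_small_add (hN i Ni) (hN j Nj) => //.
  have h1 := matched_norm (matchedB (st_ i).1 (st_ j).1).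
  have h2 := capacity_ae_measure (near_L0m_dist_triangle (s_ i) v (s_ j)).
  rewrite (L0m_norm_sub (s_ i) v) in h2.
  by apply: filterS2 h1 h2 => x ->.
exists w => D e r mD bD e0 r0.
have [N hN] := small D e r bD e0 r0 mD.
have [N' _ hN'] : \forall n \near \oo, close_in_measure D e r w (t_ n).
  by apply: tw; apply/(modM.1); exists D, e, r; split.
exists (s_ (maxn N N')), (t_ (maxn N N')); split; first exact: (st_ _).1.
- by apply: hN; exact: leq_maxl.
- by apply: hN'; exact: leq_maxr.
Qed.

Lemma ex_projection : exists P : TC -> TM, forall v, approx_matched v (P v).
Proof. by have [P hP] := choice approx_matched_total; exists P. Qed.

(** * Linearity, continuity and isometry of the projection *)

Variable P : TC -> TM.
Hypothesis approxP : forall v, approx_matched v (P v).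

Lemma projectionB v v' : P (v - v') = P v - P v'.
Proof. exact: approx_matched_fun (approxP _) (approx_matchedB _ _). Qed.

Lemma projection_grad f : T f -> P (gradbar f) = grad f.
Proof.
move=> Tf; apply: approx_matched_fun (approxP _) _.
exact/approx_matched_matched/matched_grad.
Qed.

Lemma projection_norm v : L0m_norm (P v) = Pr (L0m_norm v).
Proof.
apply/L0P; have h := approx_matched_norm (approxP v).
by apply: filterS2 h (ae_Pr (L0m_norm v)) => x -> ->.
Qed.

(** By additivity and isometry [P v - P s] has the norm of [v - s], which is small in measure for
    [s] near [v]. *)
Lemma projection_continuous : continuous P.
Proof.
move=> v U /(modM.1)[B [e [r [mB bB e0 r0 hU]]]].
apply: filterS (nbhs_meas_small v mB bB e0 r0) => s vs; apply: hU.
apply: (meas_small_le (v := L0m_norm (v - s))) vs => //.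
rewrite -projectionB; have h := approx_matched_norm (approxP (v - s)).
by apply: filterS h => x ->.
Qed.

Lemma projection_scale_rat (q : rat) v : P (ratr q *: v) = ratr q *: P v.
Proof.
pose Pa : {additive TC -> TM} :=
  HB.pack P (GRing.isZmodMorphism.Build _ _ P projectionB).
have PZn (n : nat) u : P (n%:R *: u) = n%:R *: P u by exact: (raddfZnat Pa).
have PZz (z : int) u : P (z%:~R *: u) = z%:~R *: P u.
  case: z => n; first exact: PZn.
  rewrite NegzE mulrNz !scaleNr -[LHS]/(Pa _) raddfN; congr (- _); exact: PZn.
(* Multiplying by the denominator reduces the claim to integer scalars, where additivity
   suffices. *)
have dq0 : (denq q)%:~R != 0 :> R by rewrite intr_eq0 denq_neq0.
apply: (scalerI dq0); rewrite -PZz !scalerA.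
by rewrite /ratr mulrCA divff// mulr1 PZz.
Qed.

(* Since P is only known to be additive, g is compared with rational constants
   q: both P (g v) and Pr g P v differ from q P v by at most |g - q| |v|. *)
Lemma projection_act (g : L0cap) v : P (L0m_act g v) = L0m_act (Pr g) (P v).
Proof.
apply: eq_L0m_near; set D := _ - _.
have est : {ae m, forall x (q : rat),
    L0m_norm D x <= 2 * `|g x - ratr q| * L0m_norm v x}.
  apply: ae_forall_countable => q.
  pose c1 : L0cap := g - ratr q *: (1 : L0cap).
  pose c2 : L0m := Pr g - ratr q *: (1 : L0m).
  (* Replacing [g] by [g - q] takes [q P v] away from both terms, by rational homogeneity, and so
     leaves [D] unchanged. *)
  have DE : D = P (L0m_act c1 v) - L0m_act c2 (P v).
    rewrite /c1 /c2 !L0m_actBl projectionB !L0m_act_scale projection_scale_rat.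
    by rewrite subrACA subrr subr0.
  have h1 := near_L0m_normB (P (L0m_act c1 v)) (L0m_act c2 (P v)).
  have h2 := approx_matched_norm (approxP (L0m_act c1 v)).
  have h3 := capacity_ae_measure (near_L0m_norm_act c1 v).
  have h4 := near_L0m_norm_act c2 (P v).
  have h5 := approx_matched_norm (approxP v).
  have c1E := capacity_ae_measure (near_L0_sub_scale1 g (ratr q)).
  have c2E := near_L0_sub_scale1 (Pr g) (ratr q).
  rewrite -DE in h1.
  apply: filterS2 (filterI h1 (filterI h2 h3)) (filterI h4 
    (filterI h5 (filterI (filterI c1E c2E) (ae_Pr g)))).
  move=> x [h1x [h2x h3x]] [h4x [h5x [[c1x c2x] gx]]].
  by apply: (le_trans h1x); rewrite h2x h3x h4x h5x c1x c2x gx; lra.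
have D0 := near_L0m_norm_ge0 D.
have v0 := capacity_ae_measure (near_L0m_norm_ge0 v).
apply: filterS2 est (filterI D0 v0) => x Dx [D0x v0x].
apply/eqP; rewrite eq_le D0x andbT; apply/ler_addgt0Pr => e e0; rewrite add0r.
(* A rational this close to [g x] makes the bound at most [e]; the added 1 keeps the denominator
   positive where [v] vanishes. *)
have de : 0 < e / (2 * L0m_norm v x + 1) by rewrite divr_gt0//; lra.
have gx : g x < g x + e / (2 * L0m_norm v x + 1) by rewrite ltrDl.
have [q] := rat_in_itvoo gx; rewrite in_itv/= => /andP[gq qg].
apply: le_trans (Dx q) _; rewrite distrC gtr0_norm ?subr_gt0//.
apply: (@le_trans _ _ (e / (2 * L0m_norm v x + 1) * (2 * L0m_norm v x))).
  rewrite (mulrC 2 (ratr q - _)) -(mulrA _ 2); apply: ler_wpM2r; first exact: mulr_ge0.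
  by rewrite lerBlDl ltW.
rewrite mulrAC ler_pdivrMr; last lra.
by rewrite ler_pM2l//; lra.
Qed.

(** Real homogeneity is the case of a constant function in [projection_act], whose proof needed only
    rational scalars. *)
Lemma projection_linear : linear P.
Proof.
move=> a v w.
have P0 : P 0 = 0 by have := projectionB 0 0; rewrite !subrr.
have PN u : P (- u) = - P u by rewrite -(sub0r u) projectionB P0 sub0r.
have -> : P (a *: v + w) = P (a *: v) + P w.
  by rewrite -{1}(opprK w) projectionB PN opprK.
congr (_ + _); rewrite -L0m_act_scale projection_act.
rewrite -[RHS]L0m_act_scale; congr L0m_act.
have h1 := ae_Pr (a *: (1 : L0cap)).
have h2 := capacity_ae_measure (L0_ZE a (1 : L0cap)).
have h3 := capacity_ae_measure (L0_1E (R := R) (capacity_ae_on m)).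
have h4 := L0_ZE a (1 : L0m).
have h5 := L0_1E (R := R) (measure_ae_on m).
apply/L0P; apply: filterS2 (filterI h1 h2) (filterI h3 (filterI h4 h5)) => x.
by move=> [h1x h2x] [h3x [h4x h5x]]; rewrite h1x h2x h3x h4x h5x.
Qed.

End matched.

(** * Weak upper gradients *)

Section sobolev_space.
Context {d : measure_display} {R : realType} {X : polishBorelType d R}.

(** The preimage of [U] is the trace on the interval of an open set [V] of real parameters, built
    because nothing is known of [gamma] outside it. Measurability makes integrals along [gamma]
    additive. *)
Lemma measurable_lipschitz_curve (L : R) (gamma : R -> X) :
  {in `[0, L] &, forall s t, mdist (gamma s) (gamma t) <= `|s - t|} ->
  measurable_fun `[0, L] gamma.
Proof.
move=> lip; apply: (@measurability _ _ _ _ _ _ (@open X)).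
  exact: borel_measurableE.
move=> _ [U oU <-].
pose V : set R := [set t | exists s e, [/\ s \in `[0, L], `|s - t| < e &
  ball (gamma s) e `<=` U]].
rewrite (_ : _ `&` _ = `[0, L] `&` V); last first.
  apply/seteqP; split=> t [tL tU]; split=> //.
    have : nbhs (gamma t) U by apply: open_nbhs_nbhs; split.
    move=> /nbhs_ballP[e /= e0 eU]; exists t, e; split=> //.
    by rewrite subrr normr0.
  have [s [e [sL ste eU]]] := tU; apply: eU.
  by rewrite ballEmdist/=; apply: le_lt_trans ste; exact: lip.
apply: measurableI; first exact: measurable_itv.
apply: open_measurable; rewrite openE => t [s [e [sL ste eU]]].
apply/nbhs_ballP; exists (e - `|s - t|) => /=; first by rewrite subr_gt0.
move=> z; rewrite /ball/= => tz; exists s, e; split=> //.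
have := ler_distD t s z; lra.
Qed.

Lemma upper_gradientD (f g : X -> R) (u v : X -> \bar R) :
  upper_gradient f u -> upper_gradient g v ->
  upper_gradient (fun x => f x + g x) (fun x => u x + v x)%E.
Proof.
move=> [mu u0 fu] [mv v0 gv]; split.
- exact: emeasurable_funD.
- by move=> x; rewrite adde_ge0.
- move=> L gamma L0 hg; have mg := measurable_lipschitz_curve hg.
  rewrite ge0_integralD//; first last.
  + exact: measurableT_comp mv mg.
  + exact: measurableT_comp mu mg.
  apply: (@le_trans _ _ (`|f (gamma L) - f (gamma 0)| +
                         `|g (gamma L) - g (gamma 0)|)%:E).
    by rewrite lee_fin opprD addrACA ler_normD.
  by rewrite EFinD; apply: leeD; [exact: fu|exact: gv].
Qed.

Lemma upper_gradientZ (c : R) (f : X -> R) (u : X -> \bar R) :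
  upper_gradient f u ->
  upper_gradient (fun x => c * f x) (fun x => `|c|%:E * u x)%E.
Proof.
move=> [mu u0 fu]; split.
- exact: measurable_funeM.
- by move=> x; rewrite mule_ge0// lee_fin.
- move=> L gamma L0 hg; have mg := measurable_lipschitz_curve hg.
  rewrite ge0_integralZl//; last exact: measurableT_comp mu mg.
  by rewrite -mulrBr normrM EFinM lee_wpmul2l ?lee_fin//; exact: fu.
Qed.

Variable m : {measure set X -> \bar R}.
Implicit Types f g h G H : {mfun X >-> R}.
Local Notation scal c f := ((cst c : {mfun X >-> R}) * f).

Lemma measurable_sq f : measurable_fun setT (fun x => ((f x) ^+ 2)%:E).
Proof. by apply/measurable_EFinP; exact: measurable_funX. Qed.

Lemma sqL2_ae f g : {ae m, forall x, f x = g x} -> sqL2 m f = sqL2 m g.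
Proof.
move=> fg; apply: ae_eq_integral => //; [exact: measurable_sq..|].
by apply: filterS fg => x -> _.
Qed.

Lemma sqL2Z (c : R) f : sqL2 m (fun x => c * f x) = ((c ^+ 2)%:E * sqL2 m f)%E.
Proof.
rewrite /sqL2 -ge0_integralZl//.
- by apply: eq_integral => x _; rewrite exprMn EFinM.
- exact: measurable_sq.
- by move=> x _; rewrite lee_fin sqr_ge0.
- by rewrite lee_fin sqr_ge0.
Qed.

Lemma sqL2_double_add f g (k : X -> R) : measurable_fun setT k ->
  (forall x, `|k x| <= `|f x| + `|g x|) ->
  (sqL2 m k <= (sqL2 m f + sqL2 m f) + (sqL2 m g + sqL2 m g))%E.
Proof.
move=> mk kfg; rewrite /sqL2 -!ge0_integralD//;
  do ?[exact: measurable_sq|exact: emeasurable_funD|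
    by move=> x _; rewrite ?adde_ge0// lee_fin sqr_ge0].
- apply: ge0_le_integral => //.
  + by move=> x _; rewrite lee_fin sqr_ge0.
  + by apply/measurable_EFinP; exact: measurable_funX.
  + by apply: emeasurable_funD; apply: emeasurable_funD; exact: measurable_sq.
  + move=> x _; rewrite -!EFinD lee_fin.
    rewrite -(real_normK (num_real (k x))) -(real_normK (num_real (f x))).
    rewrite -(real_normK (num_real (g x))).
    have : `|k x| ^+ 2 <= (`|f x| + `|g x|) ^+ 2.
      by rewrite lerXn2r ?nnegrE// addr_ge0.
    have := sqr_ge0 (`|f x| - `|g x|); move: `|f x| `|g x| => a b; nra.
- by apply: emeasurable_funD; exact: measurable_sq.
- by apply: emeasurable_funD; exact: measurable_sq.
Qed.

Lemma sqL2_parallelogram f g :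
  (sqL2 m (fun x => f x + g x)%R + sqL2 m (fun x => f x - g x)%R =
   (sqL2 m f + sqL2 m f) + (sqL2 m g + sqL2 m g))%E.
Proof.
rewrite /sqL2 -!ge0_integralD//;
  do ?[exact: measurable_sq|by move=> x _; rewrite ?adde_ge0// lee_fin sqr_ge0|
    by apply: emeasurable_funD; exact: measurable_sq].
- by apply: eq_integral => x _; rewrite -!EFinD; congr EFin; ring.
- exact: (measurable_sq (f + g)).
- exact: (measurable_sq (f - g)).
Qed.

Lemma cvge0_double_add (u v w : nat -> \bar R) : (forall n, 0 <= w n)%E ->
  (forall n, w n <= (u n + u n) + (v n + v n))%E ->
  u n @[n --> \oo] --> 0%E -> v n @[n --> \oo] --> 0%E ->
  w n @[n --> \oo] --> 0%E.
Proof.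
move=> w0 wuv u0 v0.
apply: (@squeeze_cvge _ _ _ _ (cst 0%E) _
  (fun n => (u n + u n) + (v n + v n))%E).
- by apply: nearW => n; rewrite w0 wuv.
- exact: cvg_cst.
- rewrite -[X in _ --> X](adde0 0%E); apply: cvgeD => //.
  + by rewrite -[X in _ --> X](adde0 0%E); apply: cvgeD.
  + by rewrite -[X in _ --> X](adde0 0%E); apply: cvgeD.
Qed.

(** An infinite [u] or [v] makes the right side infinite; for finite values the gap between the two
    sides is the square of the difference of the errors. *)
Lemma sqr_edist_double_add (u v : \bar R) (a b : R) : (0 <= u)%E -> (0 <= v)%E ->
  (`|u + v - (a + b)%:E| ^+ 2 <=
   (`|u - a%:E| ^+ 2 + `|u - a%:E| ^+ 2) + (`|v - b%:E| ^+ 2 + `|v - b%:E| ^+ 2))%E.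
Proof.
have sq0 (x : \bar R) : (0 <= `|x| ^+ 2)%E by rewrite expe2 mule_ge0.
have sqy (x : R) : (`|+oo - x%:E| ^+ 2 = +oo :> \bar R)%E by rewrite expe2 /= mulyy.
have sqN (x y : \bar R) : (`|x| ^+ 2 + `|y| ^+ 2 != -oo :> \bar R)%E.
  by rewrite gt_eqF// (lt_le_trans _ (adde_ge0 (sq0 _) (sq0 _))).
case: u => [u||] // _; last first.
  move=> v0; rewrite addye ?gt_eqF ?(lt_le_trans _ v0)// sqy.
  by rewrite [X in (_ <= X + _)%E]addye// addye ?leey.
case: v => [v||] // _.
rewrite -EFinD -!EFinB !abse_EFin -!EFin_expe -!EFinD lee_fin !real_normK ?num_real//.
by have := sqr_ge0 ((u - a) - (v - b)); nra.
Qed.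

Lemma measurable_sqr_edist (u : X -> \bar R) G : measurable_fun setT u ->
  measurable_fun setT (fun x => (`|u x - (G x)%:E| ^+ 2)%E).
Proof.
move=> mu; under eq_fun do rewrite expe2.
by apply: emeasurable_funM; apply: measurableT_comp => //;
  apply: emeasurable_funB => //; exact/measurable_EFinP.
Qed.

(** The approximating functions and their upper gradients are added term by term; the squared errors
    at most double before being summed. *)
Lemma weak_upper_gradientD f g G H :
  weak_upper_gradient m f G -> weak_upper_gradient m g H ->
  weak_upper_gradient m (f + g) (G + H).
Proof.
have sq0 (x : \bar R) : (0 <= `|x| ^+ 2)%E by rewrite expe2 mule_ge0.
move=> [fo Go [f_ [u_ [fu f_f u_G]]]] [go Ho [g_ [v_ [gv g_g v_H]]]]; split.
- apply: le_lt_trans (lte_add_pinfty (lte_add_pinfty fo fo) (lte_add_pinfty go go)).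
  by apply: sqL2_double_add => // x; exact: ler_normD.
- apply: le_lt_trans (lte_add_pinfty (lte_add_pinfty Go Go) (lte_add_pinfty Ho Ho)).
  by apply: sqL2_double_add => // x; exact: ler_normD.
exists (fun n => f_ n + g_ n), (fun n x => u_ n x + v_ n x)%E; split.
- by move=> n; exact: (upper_gradientD (fu n) (gv n)).
- apply: cvge0_double_add f_f g_g => n; first exact: sqL2_ge0.
  by apply: sqL2_double_add => // x /=; rewrite opprD addrACA ler_normD.
- apply: cvge0_double_add u_G v_H => n; first by apply: integral_ge0.
  have [mu u0 _] := fu n; have [mv v0 _] := gv n.
  have mG := measurable_sqr_edist G mu; have mH := measurable_sqr_edist H mv.
  rewrite -!ge0_integralD//;
    do ?[by move=> x _; rewrite adde_ge0|exact: emeasurable_funD].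
  apply: ge0_le_integral => //.
  + by apply: (measurable_sqr_edist (G + H)); exact: emeasurable_funD.
  + by apply: emeasurable_funD; apply: emeasurable_funD.
  + by move=> x _; exact: sqr_edist_double_add.
Qed.

Lemma weak_upper_gradientZ (c : R) f G : c != 0 ->
  weak_upper_gradient m f G ->
  weak_upper_gradient m (scal c f) (scal `|c| G).
Proof.
move=> c0 [fo Go [f_ [u_ [fu f_f u_G]]]]; split.
- by rewrite sqL2Z lte_mul_pinfty// lee_fin sqr_ge0.
- by rewrite sqL2Z lte_mul_pinfty// lee_fin sqr_ge0.
have c20 : ((c ^+ 2)%:E * 0 = 0 :> \bar R)%E by rewrite mule0.
exists (fun n => scal c (f_ n)), (fun n x => `|c|%:E * u_ n x)%E; split.
- by move=> n; exact: (upper_gradientZ c (fu n)).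
- rewrite (_ : (fun n => _) = (fun n => (c ^+ 2)%:E * sqL2 m (f_ n - f)%R)%E).
    by rewrite -[X in _ --> X]c20; apply: cvgeZl.
  apply/funext => n; rewrite -sqL2Z; apply: eq_integral => x _ /=.
  by rewrite mulrBr.
- rewrite (_ : (fun n => _) =
    (fun n => (c ^+ 2)%:E * \int[m]_x (`|u_ n x - (G x)%:E| ^+ 2))%E).
    by rewrite -[X in _ --> X]c20; apply: cvgeZl.
  apply/funext => n; have [mu u0 _] := fu n.
  rewrite -ge0_integralZl//.
  + apply: eq_integral => x _.
    have -> : ((scal `|c| G) x)%:E = (`|c|%:E * (G x)%:E)%E by [].
    rewrite -muleBr ?fin_num_adde_defl// abseM abse_EFin normr_id !expe2 muleACA -EFinM.
    by rewrite -expr2 real_normK// num_real.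
  + exact: measurable_sqr_edist.
  + by move=> x _; rewrite expe2 mule_ge0.
  + by rewrite lee_fin sqr_ge0.
Qed.

Lemma weak_upper_gradient_ae f g G : {ae m, forall x, f x = g x} ->
  weak_upper_gradient m f G -> weak_upper_gradient m g G.
Proof.
move=> fg [fo Go [f_ [u_ [fu f_f u_G]]]]; split=> //.
  by rewrite -(sqL2_ae fg).
exists f_, u_; split=> //.
rewrite (_ : (fun n => _) = (fun n => sqL2 m (f_ n - f)))//.
apply/funext => n; apply: (@sqL2_ae (f_ n - g) (f_ n - f)).
apply: filterS fg => x fgx.
by rewrite -[LHS]/(f_ n x - g x) -[RHS]/(f_ n x - f x) fgx.
Qed.

Lemma cheeger_energy_ae f g : {ae m, forall x, f x = g x} ->
  cheeger_energy m f = cheeger_energy m g.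
Proof.
move=> fg; rewrite /cheeger_energy; congr ereal_inf; apply/seteqP.
have gf : {ae m, forall x, g x = f x} by apply: filterS fg.
by split=> _ [G h <-]; exists G => //; apply: weak_upper_gradient_ae h.
Qed.

Lemma W12_ae f g : {ae m, forall x, f x = g x} -> W12 m f -> W12 m g.
Proof. by move=> fg [G fG]; exists G; exact: weak_upper_gradient_ae fG. Qed.

Lemma W12D f g : W12 m f -> W12 m g -> W12 m (f + g).
Proof. by move=> [G fG] [H gH]; exists (G + H); exact: weak_upper_gradientD. Qed.

Lemma W12N f : W12 m f -> W12 m (- f).
Proof.
move=> [G fG]; exists (scal `|-1| G).
have := weak_upper_gradientZ (c := -1) _ fG; rewrite oppr_eq0 oner_eq0 => /(_ isT).
by apply: weak_upper_gradient_ae; apply: nearW => x /=; rewrite mulN1r.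
Qed.

(** Here [c] is the minimal energy, [p] and [q] the squared norms of the sum and difference of two
    minimizers: [p] is at least four times [c], which leaves nothing for [q]. *)
Let parallelogram_eq0 (c p q : \bar R) : (0 <= c)%E -> (c < +oo)%E ->
  (0 <= p)%E -> (0 <= q)%E -> (p + q = (c + c) + (c + c))%E ->
  (c <= (2^-1 ^+ 2)%:E * p)%E -> q = 0%E.
Proof.
case: c => [c||]// c0 _; case: p => [p||]// p0; case: q => [q||]// q0.
rewrite !lee_fin in c0 p0 q0; rewrite -!EFinD => -[pq].
rewrite -EFinM lee_fin (_ : 2^-1 ^+ 2 = 4^-1); last by field.
by move=> cp; congr EFin; lra.
Qed.

(* The midpoint of two minimal weak upper gradients is again a weak upper
   gradient, so by the parallelogram identity their difference vanishes. *)
Lemma minimal_weak_upper_gradient_unique f G H :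
  is_minimal_weak_upper_gradient m f G -> is_minimal_weak_upper_gradient m f H ->
  {ae m, forall x, G x = H x}.
Proof.
move=> [fG Gmin] [fH Hmin].
have half0 : (2^-1 : R) != 0 by rewrite invr_eq0.
have wK := weak_upper_gradientZ half0 (weak_upper_gradientD fG fH).
have fK : weak_upper_gradient m f (scal `|2^-1| (G + H)).
  apply: weak_upper_gradient_ae wK; apply: nearW => x.
  by rewrite -[LHS]/(2^-1 * (f x + f x)); field.
have : (cheeger_energy m f <=
    sqL2 m (scal `|2^-1| (G + H) : {mfun X >-> R})%R)%E.
  by apply: ereal_inf_lbound; exists (scal `|2^-1| (G + H)).
rewrite sqL2Z real_normK ?num_real//.
rewrite [sqL2 m (G + H)]/(sqL2 m (fun x => G x + H x)) => cGH.
have E : sqL2 m (fun x => G x - H x) = 0%E.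
  have [_ + _] := fG; rewrite Gmin => cfin.
  have := sqL2_parallelogram G H; rewrite Gmin Hmin => GH.
  by apply: parallelogram_eq0 GH cGH; rewrite ?cheeger_energy_ge0 ?sqL2_ge0.
have : ae_eq m setT (fun x => ((G x - H x) ^+ 2)%:E) (cst 0%E).
  apply/(ae_eq_integral_abs m measurableT) => //.
    exact: (measurable_sq (G - H)).
  rewrite -E; apply: eq_integral => x _.
  by rewrite gee0_abs// lee_fin sqr_ge0.
by apply: filterS => x /(_ I) [] /eqP; rewrite sqrf_eq0 subr_eq0 => /eqP.
Qed.

End sobolev_space.

(** * Test functions *)

Section test_functions.
Context {d : measure_display} {R : realType} {X : polishBorelType d R}.
Variable m : {measure set X -> \bar R}.
Variable TM : L0_normed_module R (measure_ae_on m).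
Local Notation L0m := (L0 R (measure_ae_on m)).
Variable grad : L0m -> TM.
Hypothesis hilb : infinitesimally_hilbertian m.
Hypothesis grad_linear : forall (a : R) (f g : L0m), W12 m f -> W12 m g ->
  grad (a *: f + g) = a *: grad f + grad g.
Hypothesis grad_min : forall f : L0m, W12 m f ->
  is_minimal_weak_upper_gradient m f (L0m_norm (grad f)).
Implicit Types (f g h k : L0m) (v w : TM).

Local Notation mfun f := (f : {mfun X >-> R}).

Lemma ae_L0D f g : {ae m, forall x, (mfun f + mfun g) x = (f + g : L0m) x}.
Proof. by apply: filterS (L0_DE f g) => x ->. Qed.

Lemma ae_L0B f g : {ae m, forall x, (mfun f - mfun g) x = (f - g : L0m) x}.
Proof. by apply: filterS2 (L0_DE f (- g)) (L0_NE g) => x -> ->. Qed.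

Lemma L0_W12D f g : W12 m f -> W12 m g -> W12 m (f + g : L0m).
Proof. by move=> Wf Wg; apply: W12_ae (W12D Wf Wg); exact: ae_L0D. Qed.

Lemma L0_W12B f g : W12 m f -> W12 m g -> W12 m (f - g : L0m).
Proof. by move=> Wf Wg; apply: W12_ae (W12D Wf (W12N Wg)); exact: ae_L0B. Qed.

Lemma W12_gradD f g : W12 m f -> W12 m g -> grad (f + g) = grad f + grad g.
Proof. by move=> Wf Wg; rewrite -{1}(scale1r f) grad_linear// scale1r. Qed.

Lemma W12_gradB f g : W12 m f -> W12 m g -> grad (f - g) = grad f - grad g.
Proof.
by move=> Wf Wg; rewrite addrC -{1}(scaleN1r g) grad_linear// scaleN1r addrC.
Qed.

(** Made real-valued so that the quadratic identities become linear arithmetic; on gradients of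
    Sobolev functions [fine] loses nothing, by [sqL2_gradE]. *)
Definition dirichlet v : R := fine (sqL2 m (L0m_norm v)).

Lemma sqL2_gradE f : W12 m f ->
  sqL2 m (L0m_norm (grad f)) = (dirichlet (grad f))%:E.
Proof.
move=> Wf; rewrite fineK//; have [[_ fin _] _] := grad_min Wf.
by rewrite ge0_fin_numE// sqL2_ge0.
Qed.

Lemma cheeger_energyE f : W12 m f -> cheeger_energy m f = (dirichlet (grad f))%:E.
Proof. by move=> Wf; rewrite -sqL2_gradE//; have [_ ->] := grad_min Wf. Qed.

Lemma W12_sqL2 f : W12 m f -> sqL2 m f \is a fin_num.
Proof. by move=> [G [fin _ _]]; rewrite ge0_fin_numE// sqL2_ge0. Qed.

(** Infinitesimal Hilbertianity concerns the full Sobolev norm; subtracting the identity for the L2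
    part, all terms being finite, leaves the energies. *)
Lemma dirichlet_parallelogram f g : W12 m f -> W12 m g ->
  dirichlet (grad f + grad g) + dirichlet (grad f - grad g) =
  2 * dirichlet (grad f) + 2 * dirichlet (grad g).
Proof.
move=> Wf Wg; rewrite -W12_gradD// -W12_gradB//.
have WD := L0_W12D Wf Wg; have WB := L0_W12B Wf Wg.
have := hilb Wf Wg; rewrite /sqW12.
rewrite (cheeger_energy_ae (ae_L0D f g)) (cheeger_energy_ae (ae_L0B f g)).
rewrite !cheeger_energyE//.
have := sqL2_parallelogram m f g.
rewrite -[sqL2 m (fun x => f x + g x)]/(sqL2 m (mfun f + mfun g)).
rewrite -[sqL2 m (fun x => f x - g x)]/(sqL2 m (mfun f - mfun g)).
rewrite (sqL2_ae (ae_L0D f g)) (sqL2_ae (ae_L0B f g)).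
rewrite -(fineK (W12_sqL2 Wf)) -(fineK (W12_sqL2 Wg)).
rewrite -(fineK (W12_sqL2 WD)) -(fineK (W12_sqL2 WB)).
by rewrite -!EFinD -EFinM => -[h1] -[h2]; lra.
Qed.

Lemma dirichletN v : dirichlet (- v) = dirichlet v.
Proof. by rewrite /dirichlet L0m_normN. Qed.

Definition dirichlet_form v w : R := (dirichlet (v + w) - dirichlet (v - w)) / 4.

(** The pointwise product is itself a polarization, and both squared norms are integrable, so its
    integral splits into the two energies. *)
Lemma dirichlet_formE f g : W12 m f -> W12 m g ->
  (\int[m]_x (L0m_dot (grad f) (grad g) x)%:E =
   (dirichlet_form (grad f) (grad g))%:E)%E.
Proof.
move=> Wf Wg.
have WD := L0_W12D Wf Wg; have WB := L0_W12B Wf Wg.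
pose p := L0m_norm (grad (f + g)); pose q := L0m_norm (grad (f - g)).
have sq_int (u : L0m) : (sqL2 m u < +oo)%E ->
    m.-integrable setT (fun x => (u x ^+ 2)%:E).
  move=> ufin; apply/integrableP; split; first exact: measurable_sq.
  rewrite (eq_integral (fun x => (u x ^+ 2)%:E))// => x _.
  by rewrite gee0_abs// lee_fin sqr_ge0.
have ip : m.-integrable setT (fun x => (p x ^+ 2)%:E).
  by apply: sq_int; rewrite sqL2_gradE ?ltry.
have iq : m.-integrable setT (fun x => (q x ^+ 2)%:E).
  by apply: sq_int; rewrite sqL2_gradE ?ltry.
have dotE : {ae m, forall x, L0m_dot (grad f) (grad g) x =
    4^-1 * (p x ^+ 2 - q x ^+ 2)}.
  rewrite /L0m_dot -W12_gradD// -W12_gradB// -/p -/q.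
  have h1 := L0_ZE 4^-1 (p ^+ 2 - q ^+ 2).
  have h2 := ae_L0B (p ^+ 2) (q ^+ 2).
  have h3 := L0_ME p p; have h4 := L0_ME q q.
  apply: filterS2 (filterI h1 h2) (filterI h3 h4) => x [h1x h2x] [h3x h4x].
  rewrite h1x -h2x; congr (_ * _).
  by rewrite -[LHS]/((p ^+ 2 : L0m) x - (q ^+ 2 : L0m) x) !expr2 h3x h4x.
transitivity (\int[m]_x ((4^-1)%:E * ((p x ^+ 2)%:E - (q x ^+ 2)%:E)))%E.
  apply: ae_eq_integral => //.
  - exact/measurable_EFinP.
  - by apply: measurable_funeM; apply: emeasurable_funB; exact: measurable_sq.
  - by apply: filterS dotE => x -> _.
rewrite integralZl//; last exact: integrableB.
rewrite integralB// -/(sqL2 m p) -/(sqL2 m q) !sqL2_gradE//.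
by rewrite -EFinB -EFinM W12_gradD// W12_gradB// mulrC.
Qed.

(* Jordan-von Neumann: only additivity is needed, so the parallelogram identity
   suffices, without any continuity in the scalars. *)
Lemma dirichlet_formB f g k : W12 m f -> W12 m g -> W12 m k ->
  dirichlet_form (grad (f - g)) (grad k) =
  dirichlet_form (grad f) (grad k) - dirichlet_form (grad g) (grad k).
Proof.
move=> Wf Wg Wk; rewrite W12_gradB// /dirichlet_form.
(* In [(h1 - h2) - (h3 - h4)] the energies involving the sum of [f] and [g] cancel, and those
   involving [f - g] remain. *)
have h1 := dirichlet_parallelogram (L0_W12D Wf Wk) Wg.
have h2 := dirichlet_parallelogram (L0_W12B Wf Wk) Wg.
have h3 := dirichlet_parallelogram (L0_W12D Wg Wk) Wf.
have h4 := dirichlet_parallelogram (L0_W12B Wg Wk) Wf.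
rewrite (W12_gradD Wf Wk) in h1; rewrite (W12_gradB Wf Wk) in h2.
rewrite (W12_gradD Wg Wk) in h3; rewrite (W12_gradB Wg Wk) in h4.
move: h1 h2 h3 h4; set a := grad f; set b := grad g; set c := grad k.
rewrite (_ : a + c + b = a + b + c); last by rewrite addrAC.
rewrite (_ : a + c - b = a - b + c); last by rewrite addrAC.
rewrite (_ : a - c + b = a + b - c); last by rewrite addrAC.
rewrite (_ : a - c - b = a - b - c); last by rewrite addrAC.
rewrite (_ : b + c + a = a + b + c); last by rewrite addrAC (addrC b).
rewrite (_ : b - c + a = a + b - c); last by rewrite addrAC (addrC b).
rewrite (_ : b + c - a = - (a - b - c)); last by rewrite !opprB addrA (addrC c).
rewrite (_ : b - c - a = - (a - b + c)); last by rewrite opprD opprB addrAC.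
rewrite !dirichletN; lra.
Qed.

Lemma L2_mul_integrable (h k : L0m) : (sqL2 m h < +oo)%E -> (sqL2 m k < +oo)%E ->
  m.-integrable setT (fun x => (h x * k x)%:E).
Proof.
move=> hfin kfin; apply/integrableP; split.
  by apply/measurable_EFinP; exact: measurable_funM.
apply: (@le_lt_trans _ _ (sqL2 m h + sqL2 m k)%E); last exact: lte_add_pinfty.
rewrite /sqL2 -ge0_integralD//; do ?[exact: measurable_sq|
  by move=> x _; rewrite lee_fin sqr_ge0].
apply: ge0_le_integral => //.
- by apply: measurableT_comp => //; apply/measurable_EFinP; exact: measurable_funM.
- by apply: emeasurable_funD; exact: measurable_sq.
- move=> x _; rewrite abse_EFin -EFinD lee_fin normrM.
  rewrite -(real_normK (num_real (h x))) -(real_normK (num_real (k x))).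
  have := sqr_ge0 (`|h x| - `|k x|); have := sqr_ge0 (`|h x| + `|k x|).
  move: `|h x| `|k x| => a b; nra.
Qed.

Lemma is_laplacianB f g h k : is_laplacian grad f h -> is_laplacian grad g k ->
  is_laplacian grad (f - g) (h - k).
Proof.
move=> [Wf hfin fh] [Wg kfin gk].
have sqB : (sqL2 m (h - k : L0m)%R < +oo)%E.
  rewrite -(sqL2_ae (ae_L0B h k)).
  apply: le_lt_trans
    (lte_add_pinfty (lte_add_pinfty hfin hfin) (lte_add_pinfty kfin kfin)).
  by apply: sqL2_double_add => // x; exact: ler_normB.
split=> //; first exact: L0_W12B.
move=> w Ww; have [G [wfin _ _]] := Ww.
rewrite dirichlet_formE//; last exact: L0_W12B.
rewrite dirichlet_formB// EFinB -!dirichlet_formE// fh// gk//.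
have ih := L2_mul_integrable hfin wfin; have ik := L2_mul_integrable kfin wfin.
(* Finiteness of the second integral allows the sign to be factored out in the extended reals. *)
rewrite oppeK -fin_num_oppeB; last exact: integrable_fin_num.
congr (- _)%E; rewrite -integralB//.
apply: ae_eq_integral => //.
- by apply: emeasurable_funB; apply/measurable_EFinP; exact: measurable_funM.
- by apply/measurable_EFinP; exact: measurable_funM.
- by apply: filterS (ae_L0B h k) => x <- _; rewrite -EFinB mulrBl.
Qed.

Lemma Test_W12 f : Test grad f -> W12 m f.
Proof. by move=> [_ _ [h [Wf _ _] _]]. Qed.

(** By uniqueness of minimal weak upper gradients the bounds on [G] and [H] pass to the norms of
    [grad f] and [grad g], and the triangle inequality bounds the gradient of the difference. *)
Lemma TestB f g : Test grad f -> Test grad g -> Test grad (f - g).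
Proof.
move=> Tf Tg; have Wf := Test_W12 Tf; have Wg := Test_W12 Tg.
move: Tf Tg => [[Cf fC] [G fG [CG GC]] [h fh Wh]] [[Cg gC] [H gH [CH HC]] [k gk Wk]].
split.
- exists (Cf + Cg); apply: filterS2 (filterI fC gC) (ae_L0B f g) => x [fx gx] <-.
  by apply: le_trans (ler_normB _ _) _; exact: lerD.
- exists (L0m_norm (grad (f - g))); first exact/grad_min/L0_W12B.
  exists (CG + CH); rewrite W12_gradB//.
  have h1 := minimal_weak_upper_gradient_unique fG (grad_min Wf).
  have h2 := minimal_weak_upper_gradient_unique gH (grad_min Wg).
  have h3 := near_L0m_normB (grad f) (grad g).
  have h4 := near_L0m_norm_ge0 (grad f - grad g).
  apply: filterS2 (filterI (filterI GC HC) (filterI h1 h2)) (filterI h3 h4) => x.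
  move=> [[Gx Hx] [h1x h2x]] [h3x h4x]; rewrite ger0_norm//.
  apply: (le_trans h3x); rewrite -h1x -h2x.
  by apply: lerD; apply: le_trans (ler_norm _) _.
- exists (h - k); [exact: is_laplacianB|exact: L0_W12B].
Qed.

End test_functions.

(** * Existence, uniqueness and isometry of the projection *)

Theorem proposition2p9 (R : realType) (d : measure_display)
    (X : polishBorelType d R) (m : {measure set X -> \bar R}) (K : R)
    (A : nat -> set X)
    (TM : L0_normed_module R (measure_ae_on m)) (grad : L0 R (measure_ae_on m) -> TM)
    (TC : L0_normed_module R (capacity_ae_on m)) (gradbar : L0 R (measure_ae_on m) -> TC) :
  finite_on_balls m -> RCDoo m K -> capacity_exhaustion m A ->
  is_tangent_module grad -> is_tangent_capacity_module A grad gradbar ->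
  (exists! Prbar : TC -> TM, is_Prbar grad gradbar Prbar) /\
  (forall Prbar : TC -> TM, is_Prbar grad gradbar Prbar ->
    forall v : TC, L0m_norm (Prbar v) = Pr (L0m_norm v)).
Proof.
move=> finm [hilb _] exhA [modM gradl gradmin _] [modC gradbarl gradbarmin denseC].
have TB f g : Test grad f -> Test grad g -> Test grad (f - g).
  exact: TestB.
have gradB f g : Test grad f -> Test grad g -> grad (f - g) = grad f - grad g.
  by move=> /Test_W12 Wf /Test_W12 Wg; exact: W12_gradB.
have gradbarB f g : Test grad f -> Test grad g ->
    gradbar (f - g) = gradbar f - gradbar g.
  by move=> Tf Tg; rewrite addrC -{1}(scaleN1r g) gradbarl// scaleN1r addrC.
have grad_norm f : Test grad f ->
    {ae m, forall x, L0m_norm (grad f) x = L0m_norm (gradbar f) x}.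
  move=> Tf; have [G fG [_ GE]] := gradbarmin _ Tf.
  (* The norms of both gradients represent the minimal weak upper gradient of [f], which is
     unique. *)
  have h1 := minimal_weak_upper_gradient_unique fG (gradmin _ (Test_W12 Tf)).
  by rewrite -GE in h1; apply: filterS2 h1 (ae_Pr (L0m_norm (gradbar f))) => x <- ->.
have T0 : Test grad !=set0.
  have [s [_ [E [mE [f [_ _ Tf _]]]]]] := denseC setT (ex_intro _ 0 I) openT.
  by exists (f 0%N).
(* Every admissible operator has its graph in the closure of the matched pairs; this yields both the
   norm identity and uniqueness. *)
have approx P : is_Prbar grad gradbar P ->
    forall v, approx_matched grad gradbar (Test grad) v (P v).
  move=> [lP cP Pf Pact] v.
  exact: (approx_matched_projection exhA modC modM denseC v lP cP Pf Pact).
split; last by move=> P /approx hP; exact: (projection_norm grad_norm hP).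
have [P hP] :=
  ex_projection TB gradB gradbarB grad_norm T0 finm exhA modC modM denseC.
exists P; split.
  split.
  - exact: (projection_linear TB gradB gradbarB grad_norm hP).
  - exact: (projection_continuous TB gradB gradbarB grad_norm exhA modC modM hP).
  - exact: (projection_grad TB gradB gradbarB grad_norm hP).
  - exact: (projection_act TB gradB gradbarB grad_norm hP).
move=> P' /approx hP'; apply/funext => v.
exact: (approx_matched_fun TB gradB gradbarB grad_norm (hP v) (hP' v)).
Qed.
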